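(* (a) A sequence $\tau=(\tau_n)_{n=0}^\infty\in\mathbb{C}^\infty$ is an analytic moment functional on $(l_{\mathrm{fin}},\ast)$ if and only if the function $$k(\lambda):=\sum_{n=0}^\infty\frac{\lambda^n}{n!}\tau_n$$ is well defined and exponentially convex in some neighborhood of zero in $\mathbb{R}$ (i.e. there is $a>0$ such that the series converges on $(-2a,2a)$ and $k$ is exponentially convex on $(-2a,2a)$). (b) Vice versa, let $\mathcal{U}=(-2a,2a)$ with $0<a\le\infty$ and let $k:\mathcal{U}\to\mathbb{C}$ be analytic in $\mathcal{U}$. Then $k$ is exponentially convex if and only if the sequence $\tau=(\tau_n)_{n=0}^\infty$, $\tau_n:=k^{(n)}(0)=\frac{d^n}{d\lambda^n}k(\lambda)\big|_{\lambda=0}$, is an analytic moment functional on $(l_{\mathrm{fin}},\ast)$.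
   Context: $\mathbb{C}^\infty$ is the space of all complex sequences, $l_{\mathrm{fin}}$ its subspace of finitely supported sequences, and $\ast$ is the Cauchy product $(f\ast g)_n=\sum_{i+j=n}f_ig_j$ on $l_{\mathrm{fin}}$. A function $k:(-2a,2a)\to\mathbb{C}$, $0<a\le\infty$, is called exponentially convex if $\sum_{i,j=0}^\infty k(x_i+x_j)f_i\bar f_j\ge0$ for all $f=(f_n)_{n=0}^\infty\in l_{\mathrm{fin}}$ and all points $x_i\in(-a,a)$, $i\in\{0,1,2,\dots\}$. $\mathcal{M}_a(\mathbb{R})$ is the set of non-negative finite Borel measures $\mu$ on $\mathbb{R}$ whose Laplace transform $l_\mu(\lambda)=\int_{\mathbb{R}}e^{x\lambda}\,d\mu(x)$ is well-defined in a neighborhood of $0\in\mathbb{C}$ and holomorphic at $0$. $\tau$ is an analytic moment functional on $(l_{\mathrm{fin}},\ast)$ if there is $\mu\in\mathcal{M}_a(\mathbb{R})$ with $\tau_n=\int_{\mathbb{R}}x^n\,d\mu(x)$ for all $n\ge0$. *)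

(* Defs.v *)
From HB Require Import structures.
From mathcomp Require Import all_boot all_order all_algebra.
From mathcomp Require Import complex.
From mathcomp Require Import all_classical all_reals all_analysis.

Set Implicit Arguments.
Unset Strict Implicit.
Unset Printing Implicit Defensive.

Import Order.TTheory GRing.Theory Num.Theory.
Import numFieldNormedType.Exports.

Local Open Scope classical_set_scope.
Local Open Scope ring_scope.
Local Open Scope complex_scope.

(* R[i] carries no topology by default: give it the norm topology that every
   numFieldType has as a normed module over itself. *)
HB.instance Definition _ (R : rcfType) := PseudoPointedMetric.copy R[i] R[i]^o.
HB.instance Definition _ (R : rcfType) := GRing.ComAlgebra.copy R[i] R[i]^o.
HB.instance Definition _ (R : rcfType) := Vector.copy R[i] R[i]^o.
HB.instance Definition _ (R : rcfType) := NormedModule.copy R[i] R[i]^o.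
HB.instance Definition _ (R : rcfType) := Num.ClosedField.on R[i].

(* The interval (-b, b), for b possibly +oo. *)
Definition sym_itv (R : realType) (b : \bar R) : set R :=
  [set x | (- b < x%:E)%E /\ (x%:E < b)%E].

(* The space l_fin. *)
Definition finitely_supported (R : realType) (f : nat -> R[i]) : Prop :=
  finite_set [set n | f n != 0].

(* Only the values of k on sym_itv (2 * a) matter.  The sums have finite
   support, so they are the genuine ones; 0 <= z in R[i] means that z is real
   and nonnegative. *)
Definition exponentially_convex (R : realType) (a : \bar R) (k : R -> R[i]) :
    Prop :=
  forall (f : nat -> R[i]) (x : nat -> R),
    finitely_supported f ->
    (forall i, sym_itv a (x i)) ->
    0 <= \sum_(i \in [set: nat]) \sum_(j \in [set: nat])
           k (x i + x j) * f i * (f j)^*.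

Definition cexp (R : realType) (z : R[i]) : R[i] :=
  (expR (complex.Re z))%:C *
  (cos (complex.Im z) +i* sin (complex.Im z)).

Definition cintegrable (R : realType)
    (mu : {finite_measure set (measurableTypeR R) -> \bar R})
    (f : R -> R[i]) : Prop :=
  mu.-integrable [set: measurableTypeR R] (fun x => (complex.Re (f x))%:E) /\
  mu.-integrable [set: measurableTypeR R] (fun x => (complex.Im (f x))%:E).

Definition cintegral (R : realType)
    (mu : {finite_measure set (measurableTypeR R) -> \bar R})
    (f : R -> R[i]) : R[i] :=
  Rintegral mu [set: measurableTypeR R] (fun x => complex.Re (f x)) +i*
  Rintegral mu [set: measurableTypeR R] (fun x => complex.Im (f x)).

Definition laplace (R : realType)
    (mu : {finite_measure set (measurableTypeR R) -> \bar R})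
    (l : R[i]) : R[i] :=
  cintegral mu (fun x => cexp (x%:C * l)).

Definition holomorphic_at (R : realType) (g : R[i] -> R[i]) (z0 : R[i]) : Prop :=
  \forall z \near z0, derivable g z 1.

(* Membership in M_a(R). *)
Definition has_analytic_laplace (R : realType)
    (mu : {finite_measure set (measurableTypeR R) -> \bar R}) : Prop :=
  (\forall l \near (0 : R[i]), cintegrable mu (fun x => cexp (x%:C * l))) /\
  holomorphic_at (laplace mu) 0.

Definition analytic_moment_functional (R : realType) (tau : nat -> R[i]) :
    Prop :=
  exists mu : {finite_measure set (measurableTypeR R) -> \bar R},
    has_analytic_laplace mu /\
    forall n, cintegrable mu (fun x => x%:C ^+ n) /\
              tau n = cintegral mu (fun x => x%:C ^+ n).

Definition exp_series (R : realType) (tau : nat -> R[i]) (l : R) :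
    nat -> R[i] :=
  series (fun n => l%:C ^+ n / (n`!)%:R * tau n).

Definition real_analytic_on (R : realType) (U : set R) (k : R -> R[i]) : Prop :=
  forall x0, U x0 -> exists c : nat -> R[i],
    \forall x \near x0,
      series (fun n => c n * (x - x0)%:C ^+ n) @ \oo --> k x.

(* The derivative of a complex-valued function of a real variable; [derive1]
   does not apply because domain and codomain are not over the same field. *)
Definition cderive1 (R : realType) (k : R -> R[i]) (x : R) : R[i] :=
  lim ((fun h : R => (k (x + h) - k x) / h%:C) @ 0^').

Definition cderive1n (R : realType) (n : nat) (k : R -> R[i]) : R -> R[i] :=
  iter n (@cderive1 R) k.

(* Main.v *)
(** If [k] is exponentially convex with Taylor coefficients [tau n / n!] at 0,
    sampling [k] at the points [m * h] with weights dual to the monomials and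
    letting [h] tend to 0 shows that [tau] is nonnegative on squares of real
    polynomials, hence on all polynomials that are nonnegative on the line.
    M. Riesz's extension theorem extends [tau] to a positive functional on the
    indicators of half-lines; its distribution function gives a Stieltjes
    measure with moments [tau], and the convergence of the series for [k] bounds
    its exponential moments, so that its Laplace transform is holomorphic at 0.

    Conversely a Laplace transform is exponentially convex because the form is
    the integral of a square.  In (b) the measure only represents [k] near 0, so
    the identity must be continued to all of [(-2a, 2a)]: the points where every
    exponential moment is finite and equals the corresponding derivative of [k]
    form a set that is open (power series) and closed along segments from 0
    (Fatou for the even moments, then dominated convergence). *)

From HB Require Import structures.
Require Import Defs.
From mathcomp Require Import all_boot all_order all_algebra.
From mathcomp Require Import complex.
From mathcomp Require Import all_classical all_reals all_analysis.
From mathcomp Require Import measurable_realfun zify ring lra.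
Set Implicit Arguments.
Unset Strict Implicit.
Unset Printing Implicit Defensive.
Import Order.TTheory GRing.Theory Num.Theory.
Import numFieldNormedType.Exports.
Local Open Scope classical_set_scope.
Local Open Scope ring_scope.
Local Open Scope complex_scope.

(** * Real-valued integration *)

(** Integrability of [exp_weight x r], that is of e^(xt + r|t|), is the one condition to which the
    analytic statements about a measure are reduced: up to constants it dominates every moment at x
    and the complex exponentials e^(zt) with |Re z - x| <= r. The continuation in (b) propagates all
    derivatives of [k] and not just its values. Openness needs the Taylor coefficients of [k] at a
    point to be moments; only then does convergence of its power series make a weight integrable.
    The continuation runs along segments from 0 because e^(sxt) <= 1 + e^(xt) for 0 <= s <= 1, so
    that integrability at the two ends dominates everything in between. *)

Section RealIntegrable.
Context {R : realType} (mu : {finite_measure set (measurableTypeR R) -> \bar R}).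

Definition rintegrable (f : R -> R) := mu.-integrable setT (EFin \o f).
Definition rintegral (f : R -> R) := Rintegral mu setT f.

Lemma rintegrable_measurable f : rintegrable f -> measurable_fun setT f.
Proof. by move=> /integrableP[/measurable_EFinP]. Qed.

Lemma rintegralE f : rintegrable f ->
  (\int[mu]_x (f x)%:E)%E = (rintegral f)%:E.
Proof.
by move=> fi; rewrite /rintegral /Rintegral fineK //; apply: (integrable_fin_num _ fi).
Qed.

Lemma rintegrable_cst c : rintegrable (fun=> c).
Proof. exact: finite_measure_integrable_cst. Qed.

Lemma rintegrableD f g : rintegrable f -> rintegrable g ->
  rintegrable (fun x => f x + g x).
Proof. by move=> fi gi; exact: (integrableD _ fi gi). Qed.

Lemma rintegrableB f g : rintegrable f -> rintegrable g ->
  rintegrable (fun x => f x - g x).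
Proof. by move=> fi gi; exact: (integrableB _ fi gi). Qed.

Lemma rintegrableZ c f : rintegrable f -> rintegrable (fun x => c * f x).
Proof. by move=> fi; exact: (integrableZl _ _ fi). Qed.

Lemma rintegrable_norm f : rintegrable f -> rintegrable (fun x => `|f x|).
Proof. by move=> fi; exact: (integrable_norm fi). Qed.

Lemma rintegrable_le (f g : R -> R) : measurable_fun setT f ->
  (forall x, `|f x| <= g x) -> rintegrable g -> rintegrable f.
Proof.
move=> mf fg; apply: le_integrable => //; first exact/measurable_EFinP.
by move=> x _ /=; rewrite lee_fin (le_trans (fg x)) // ler_norm.
Qed.

Lemma rintegrable_sum (I : Type) (s : seq I) (P : pred I) (f : I -> R -> R) :
  (forall i, P i -> rintegrable (f i)) ->
  rintegrable (fun x => \sum_(i <- s | P i) f i x).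
Proof.
move=> fi; rewrite /rintegrable (_ : _ \o _ = fun x => (\sum_(i <- s | P i) (f i x)%:E)%E).
  exact: integrable_sum.
by apply/funext => x; rewrite /= sumEFin.
Qed.

Lemma rintegral_cst c : rintegral (fun=> c) = c * fine (mu setT).
Proof. exact: Rintegral_cst. Qed.

Lemma rintegralD f g : rintegrable f -> rintegrable g ->
  rintegral (fun x => f x + g x) = rintegral f + rintegral g.
Proof. exact: RintegralD. Qed.

Lemma rintegralB f g : rintegrable f -> rintegrable g ->
  rintegral (fun x => f x - g x) = rintegral f - rintegral g.
Proof. exact: RintegralB. Qed.

Lemma rintegralZ c f : rintegrable f ->
  rintegral (fun x => c * f x) = c * rintegral f.
Proof. exact: RintegralZl. Qed.

Lemma rintegral_sum (I : Type) (s : seq I) (P : pred I) (f : I -> R -> R) :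
  (forall i, P i -> rintegrable (f i)) ->
  rintegral (fun x => \sum_(i <- s | P i) f i x) =
  \sum_(i <- s | P i) rintegral (f i).
Proof.
move=> fi; elim: s => [|i s IH].
  under [X in rintegral X]eq_fun do rewrite big_nil.
  by rewrite rintegral_cst mul0r big_nil.
under [X in rintegral X]eq_fun do rewrite big_cons.
rewrite big_cons -IH; case: ifPn => // Pi.
by rewrite rintegralD //; [exact: fi|exact: rintegrable_sum].
Qed.

Lemma rintegral_ge0 f : (forall x, 0 <= f x) -> 0 <= rintegral f.
Proof. by move=> f0; exact: Rintegral_ge0. Qed.

Lemma rintegral_le f g : rintegrable f -> rintegrable g ->
  (forall x, f x <= g x) -> rintegral f <= rintegral g.
Proof. by move=> fi gi fg; apply: le_Rintegral. Qed.

Lemma rintegral_norm_le f g : rintegrable f -> rintegrable g ->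
  (forall x, `|f x| <= g x) -> `|rintegral f| <= rintegral g.
Proof.
move=> fi gi fg; apply: le_trans (le_normr_Rintegral _ fi) _ => //.
by apply: rintegral_le => //; exact: rintegrable_norm.
Qed.

(** Integrability is a conclusion here: a uniform bound on the integrals of nonnegative approximants
    is how finiteness of even moments and of exponential weights gets established. *)
Lemma rintegrable_fatou (s : nat -> R -> R) (f : R -> R) (B : R) :
  (forall n, rintegrable (s n)) -> (forall n x, 0 <= s n x) ->
  measurable_fun setT f ->
  (forall x, s n x @[n --> \oo] --> f x) -> (forall n, rintegral (s n) <= B) ->
  rintegrable f /\ rintegral f <= B.
Proof.
move=> si s0 mf sf sB.
have f0 x : 0 <= f x.
  rewrite -(cvg_lim _ (sf x)) //; apply: limr_ge; last exact: nearW.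
  by apply/cvg_ex; eexists; exact: sf.
have fE x : (f x)%:E = limn_einf (fun n => (s n x)%:E).
  have /cvg_EFin : \forall n \near \oo, (s n x)%:E \is a fin_num by exact: nearW.
  move=> /(_ (f x)) /(_ (sf x)) h.
  by rewrite is_cvg_limn_einfE ?(cvg_lim _ h) //; apply/cvg_ex; exists (f x)%:E.
have le : (\int[mu]_x (f x)%:E <= B%:E)%E.
  under eq_integral do rewrite fE.
  apply: le_trans (fatou mu _ _ _) _ => //.
  - by move=> n; have /measurable_int := si n.
  - by move=> n x _; rewrite lee_fin.
  rewrite limn_einf_lim; apply: lime_le; first exact: is_cvg_einfs.
  apply: nearW => n; apply: (@le_trans _ _ (\int[mu]_x (s n x)%:E)%E).
    by apply: ereal_inf_lbound; exists n => //=.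
  by rewrite rintegralE // lee_fin.
have fi : rintegrable f.
  apply/integrableP; split; first exact/measurable_EFinP.
  apply: le_lt_trans (ltry B); apply: le_trans le.
  by under eq_integral => x _ do rewrite /= ger0_norm //.
by split => //; rewrite -lee_fin -rintegralE.
Qed.

Lemma rintegral_dominated (s : nat -> R -> R) (f g : R -> R) :
  (forall n, measurable_fun setT (s n)) -> measurable_fun setT f ->
  (forall x, s n x @[n --> \oo] --> f x) -> rintegrable g ->
  (forall n x, `|s n x| <= g x) ->
  rintegrable f /\ rintegral (s n) @[n --> \oo] --> rintegral f.
Proof.
move=> ms mf sf gi sg.
have [] := @dominated_convergence _ _ _ mu setT measurableT
   (fun n => EFin \o s n) (EFin \o f) (EFin \o g).
- by move=> n; apply/measurable_EFinP; exact: ms.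
- by apply/measurable_EFinP; exact: mf.
- by apply: aeW => x _; apply/cvg_EFin; [exact: nearW|exact: sf].
- exact: gi.
- by apply: aeW => x n _; rewrite /= lee_fin.
move=> fi _ cv; split => //.
by apply: fine_cvg; rewrite -rintegralE //; exact: cv.
Qed.

End RealIntegrable.

(** * Nonnegative polynomials and the Hamburger moment problem *)

(** A functional is encoded by its graph, so its domain needs no type of its own. Single-valuedness
    follows from linearity and positivity: subtract two pairs with the same function, in both
    orders. *)
Lemma riesz_extension (R : realType) (T : Type) (G0 : set ((T -> R) * R)) :
  G0 (fun=> 0, 0) ->
  (forall f r g s c, G0 (f, r) -> G0 (g, s) ->
     G0 (fun x => f x + c * g x, r + c * s)) ->
  (forall f r, G0 (f, r) -> (forall x, 0 <= f x) -> 0 <= r) ->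
  exists G : set ((T -> R) * R),
    [/\ G0 `<=` G,
        forall f r g s c, G (f, r) -> G (g, s) ->
          G (fun x => f x + c * g x, r + c * s),
        forall f r, G (f, r) -> (forall x, 0 <= f x) -> 0 <= r &
        forall f g s h u, G0 (g, s) -> G0 (h, u) ->
          (forall x, g x <= f x) -> (forall x, f x <= h x) ->
          exists r, G (f, r)].
Proof.
move=> G00 G0lin G0pos.
pose P (G : set ((T -> R) * R)) :=
  [/\ forall f r g s c, G (f, r) -> G (g, s) ->
          G (fun x => f x + c * g x, r + c * s) &
      forall f r, G (f, r) -> (forall x, 0 <= f x) -> 0 <= r].
(* Zorn's lemma runs over the unions of [G0] with [G], so a maximal graph extends [G0]. *)
have [F FP Ftot|G [[Glin Gpos] Gmax]] :=
    @Zorn_bigcup _ (fun G => P (G0 `|` G)).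
  split.
    move=> f r g s c [G0f|[X FX Xf]] [G0g|[Y FY Yg]].
    - by left; exact: G0lin.
    - have [/(_ f r g s c) H _] := FP _ FY.
      case: H; [by left|by right|by left|by move=> ?; right; exists Y].
    - have [/(_ f r g s c) H _] := FP _ FX.
      case: H; [by right|by left|by left|by move=> ?; right; exists X].
    - have [XY|YX] := Ftot _ _ FX FY.
        have [/(_ f r g s c) H _] := FP _ FY.
        by case: H; [right; exact: XY|by right|by left|by move=> ?; right; exists Y].
      have [/(_ f r g s c) H _] := FP _ FX.
      by case: H; [by right|right; exact: YX|by left|by move=> ?; right; exists X].
  move=> f r [G0f|[X FX Xf]]; first exact: G0pos.
  by have [_ /(_ f r)] := FP _ FX; apply; right.
exists (G0 `|` G); split => //.
move=> f g s h u G0g G0h gf fh.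
pose H := G0 `|` G.
have H0 : H (fun=> 0, 0) by left.
have HG0 : G0 `<=` H by move=> x; left.
pose lo := [set r | exists2 k, H (k, r) & forall x, k x <= f x].
have loub k r : H (k, r) -> (forall x, f x <= k x) -> ubound lo r.
  move=> Hk fk q [l Hl lf].
  have := Gpos _ _ (Glin _ _ _ _ (-1) Hk Hl).
  rewrite mulN1r subr_ge0; apply=> x.
  by rewrite mulN1r subr_ge0 (le_trans (lf x)).
have los : lo s by exists g => //; exact: HG0.
have lou : has_sup lo.
  by split; [exists s|exists u; exact: loub (HG0 _ G0h) fh].
pose r0 := sup lo.
have lor k r : H (k, r) -> (forall x, k x <= f x) -> r <= r0.
  by move=> Hk kf; apply: ub_le_sup; [exact: (proj2 lou)|exists k].
have upr k r : H (k, r) -> (forall x, f x <= k x) -> r0 <= r.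
  by move=> Hk fk; apply: ge_sup; [exists s|exact: loub Hk fk].
exists r0; apply: contrapT => nHf.
pose G' := [set p : (T -> R) * R | exists k r c,
  H (k, r) /\ p = (fun x => k x + c * f x, r + c * r0)].
have HG' : H `<=` G'.
  move=> [k r] Hk; exists k, r, 0; split => //.
  by rewrite mul0r addr0; congr pair; apply/funext => x; rewrite mul0r addr0.
have G'f : G' (f, r0).
  exists (fun=> 0), 0, 1; split => //.
  by rewrite mul1r add0r; congr pair; apply/funext => x; rewrite mul1r add0r.
apply: (Gmax G').
  split; first by move=> p Gp; apply: HG'; right.
  by move=> /(_ _ G'f) Gf; apply: nHf; right.
have -> : G0 `|` G' = G' by apply/setUidPr => p G0p; apply: HG'; left.
split.
  move=> k1 q1 k2 q2 c [k [r [d [Hk [-> ->]]]]] [l [q [e [Hl [-> ->]]]]].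
  exists (fun x => k x + c * l x), (r + c * q), (d + c * e); split.
    exact: Glin.
  by congr pair; [apply/funext => x|]; ring.
move=> k1 q1 [k [r [c [Hk [-> ->]]]]] pos.
have Hsc b : H (fun x => b * k x, b * r).
  have := Glin _ _ _ _ b H0 Hk; rewrite add0r.
  by under eq_fun do rewrite add0r.
(* For nonzero c, positivity of k + c f compares f with -k/c, which leads back to the choice of
   [r0]. *)
have [c0|c0|c0] := ltrgt0P c.
- have := lor _ _ (Hsc (- c^-1)).
  rewrite mulNr -lerBlDl sub0r -mulN1r => /(_ _)/wrap[x|].
    have := pos x; rewrite mulNr lerNl -ler_pdivrMl ?invr_gt0 // invrK mulrN => ?; lra.
  rewrite mulN1r lerNl -ler_pdivrMl ?invr_gt0 // invrK mulrN => ?; lra.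
- have := upr _ _ (Hsc (- c^-1)) => /(_ _)/wrap[x|].
    have := pos x; rewrite mulNr lerNr -ler_ndivrMl ?invr_lt0 // invrK mulrN => ?; lra.
  rewrite mulNr lerNr -ler_ndivrMl ?invr_lt0 // invrK mulrN => ?; lra.
- rewrite c0 mul0r addr0; apply: Gpos Hk _ => x.
  by have := pos x; rewrite c0 mul0r addr0.
Qed.

(** Serves to show that real roots of nonnegative polynomials are double: it is applied to a
    quotient and to its reflection about the root. *)
Lemma horner_ge0_right_limit (R : realType) (q : {poly R}) (a : R) :
  (forall x, a < x -> 0 <= q.[x]) -> 0 <= q.[a].
Proof.
move=> q0; rewrite leNgt; apply/negP => qa.
have /cvgr_lt/(_ _ qa) : (q.[x] @[x --> a] --> q.[a]) by exact: continuous_horner.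
move=> /nbhs_ballP[e /= e0 /(_ (a + e / 2))].
rewrite /ball /= opprD addNKr normrN gtr0_norm; last by rewrite divr_gt0.
have e2 : e / 2 < e by rewrite ltr_pdivrMr // ltr_pMr // ltr1n.
move=> /(_ e2); rewrite ltNge q0 // ltrDl divr_gt0 //.
Qed.

(** A complex root a + ib splits off the real quadratic factor (X - a)^2 + b^2, itself a sum of two
    squares, and leaves a nonnegative quotient of smaller degree. *)
Lemma nonneg_poly_sum_two_squares (R : realType) (p : {poly R}) :
  (forall x, 0 <= p.[x]) -> exists A B : {poly R}, p = A ^+ 2 + B ^+ 2.
Proof.
have [n] := ubnP (size p); elim: n p => // n IH p /ltnSE sp p0.
have [/size1_polyC pE|p1] := leqP (size p) 1.
  exists (Num.sqrt p`_0)%:P, 0; rewrite expr0n addr0 -rmorphXn sqr_sqrtr //.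
  by have := p0 0; rewrite pE hornerC coefC.
have step (d q : {poly R}) : d \is monic -> size d = 3%N -> p = q * d ->
    (exists a b, d = ('X - a%:P) ^+ 2 + b%:P ^+ 2) ->
    (forall x, 0 <= q.[x]) -> exists A B : {poly R}, p = A ^+ 2 + B ^+ 2.
  move=> dm sd pE [a [b dE]] q0.
  have qn0 : q != 0 by apply: contraTneq p1 => q0'; rewrite pE q0' mul0r size_poly0.
  have [|A [B qE]] := IH q _ q0.
    by move: sp; rewrite pE size_Mmonic // sd addn3 /=; apply: leq_trans; rewrite ltnS.
  (* The identity by which a product of two sums of two squares is again one. *)
  exists (A * ('X - a%:P) - B * b%:P), (A * b%:P + B * ('X - a%:P)).
  by rewrite pE qE dE; ring.
have [[a b] rz] : exists z : R[i], root (map_poly (real_complex R) p) z.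
  by apply/closed_rootP; rewrite size_map_poly gtn_eqF.
(* A real root is double: the quotient q is nonnegative to the right of a and nonpositive to the
   left, so q(a) = 0. *)
have [b0|b0] := eqVneq b 0.
  have ra : root p a.
    by move: rz; rewrite b0 -/(real_complex R a) fmorph_root.
  have [q pE] := factor_theorem p a ra.
  have qx x : 0 <= q.[x] * (x - a) by have := p0 x; rewrite pE hornerM hornerXsubC.
  have q_r : 0 <= q.[a].
    by apply: horner_ge0_right_limit => x ax; have := qx x; rewrite pmulr_lge0 // subr_gt0.
  have q_l : 0 <= (- (q \Po ((2 * a)%:P - 'X))).[a].
    apply: horner_ge0_right_limit => x ax; have := qx (2 * a - x).
    rewrite nmulr_lge0; last by lra.
    by rewrite hornerN horner_comp !hornerE oppr_ge0.
  have /factor_theorem[r qE] : root q a.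
    move: q_l; rewrite hornerN horner_comp !hornerE oppr_ge0 mulr2n mulrDl mul1r addrK => q_l.
    by rewrite rootE eq_le q_l q_r.
  have rx x : x != a -> 0 <= r.[x].
    move=> xa; have := qx x; rewrite qE hornerM hornerXsubC -mulrA -expr2.
    by rewrite pmulr_lge0 // exprn_even_gt0 // subr_eq0.
  apply: (step (('X - a%:P) ^+ 2) r).
  - by rewrite monic_exp // monicXsubC.
  - by rewrite size_exp_XsubC.
  - by rewrite pE qE expr2 mulrA.
  - by exists a, 0; rewrite polyC0 expr0n addr0.
  - move=> x; have [->|] := eqVneq x a; last exact: rx.
    by apply: horner_ge0_right_limit => y ay; rewrite rx // gt_eqF.
pose d : {poly R} := ('X - a%:P) ^+ 2 + b%:P ^+ 2.
have sd : size d = 3%N.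
  by rewrite size_polyDl size_exp_XsubC // -rmorphXn size_polyC; case: (_ != _).
have dm : d \is monic.
  rewrite monicE lead_coefDl ?lead_coef_exp ?lead_coefXsubC ?expr1n //.
  by rewrite size_exp_XsubC // -rmorphXn size_polyC; case: (_ != _).
have dx x : d.[x] = (x - a) ^+ 2 + b ^+ 2 by rewrite /d !hornerE.
have dgt0 x : 0 < d.[x].
  by rewrite dx ltr_wpDl ?sqr_ge0 // exprn_even_gt0.
have pE := divp_eq p d.
have sr : (size (p %% d)%R <= 2)%N by have := ltn_modp p d; rewrite sd monic_neq0.
(* The remainder has degree at most 1 and vanishes at the non-real number a + ib; imaginary and real
   parts kill its two coefficients. *)
have r0 : p %% d = 0.
  set r : {poly R} := (p %% d)%R in pE sr *.
  have rE : r = (r`_0)%:P + (r`_1)%:P * 'X.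
    apply/polyP => -[|[|i]]; rewrite !coefE ?coefMX ?coefC /= ?mulr1 ?mulr0 ?addr0 ?add0r //.
    by rewrite nth_default // (leq_trans sr).
  have dz : (map_poly (real_complex R) d).[a +i* b] = 0.
    rewrite rmorphD !rmorphXn rmorphB /= map_polyX !map_polyC !hornerE /=.
    by apply/eqP; rewrite eq_complex !expr2 /=; apply/andP; split; apply/eqP; ring.
  move: rz; rewrite rootE pE rmorphD rmorphM hornerD hornerM dz [in X in _ + X]rE.
  rewrite rmorphD rmorphM /= map_polyX !map_polyC !hornerE.
  rewrite eq_complex /= => /andP[/eqP e1 /eqP e2].
  have u0 : r`_1 = 0.
    by apply: (mulIf b0); rewrite mul0r -[RHS]e2; ring.
  have v0 : r`_0 = 0 by rewrite -[RHS]e1 u0; ring.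
  by rewrite rE u0 v0 polyC0 mul0r addr0.
apply: (step d (p %/ d)) => //; first by rewrite {1}pE r0 addr0.
  by exists a, b.
move=> x; have := p0 x; rewrite {1}pE r0 addr0 hornerM pmulr_lge0 //.
Qed.

(* [F] need not be right-continuous: the measure comes from its right limits,
   whence the shift by [d]. *)
Lemma stieltjes_of_monotone (R : realType) (F : R -> R) (M : R) :
  {homo F : x y / x <= y} -> (forall x, 0 <= F x <= M) ->
  exists mu : {finite_measure set (measurableTypeR R) -> \bar R},
    forall u v, u <= v ->
      F (v + d) - F (u + d) @[d --> 0^'+] --> fine (mu `]u, v]%classic).
Proof.
move=> Fnd F0M.
(* The right limit of the monotone [F], hence its right-continuous version. *)
pose G (x : R) := inf (F @` `]x, +oo[).
have Flb x : has_lbound (F @` `]x, +oo[).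
  by exists 0 => _ [y _ <-]; have /andP[] := F0M y.
have FG x : F y @[y --> x^'+] --> G x.
  by apply: nondecreasing_at_right_cvgr => //; [move=> a b _ _; exact: Fnd].
have GF x y : x < y -> G x <= F y.
  by move=> xy; apply: ge_inf => //; exists y => //=; rewrite in_itv /= xy.
have FleG x y : x <= y -> F x <= G y.
  move=> xy; apply: lb_le_inf.
    by exists (F (y + 1)), (y + 1) => //=; rewrite in_itv /= andbT ltrDl.
  move=> w [z /=]; rewrite in_itv /= andbT => yz <-.
  by apply: Fnd; rewrite (le_trans xy) // ltW.
have Gnd : nondecreasing G.
  move=> x y; rewrite le_eqVlt => /predU1P[->//|xy].
  by rewrite (le_trans (GF _ _ xy)) // FleG.
have Grc : right_continuous G.
  move=> x; apply/cvgrPdist_le => e e0.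
  have /cvgrPdist_le/(_ _ e0) := FG x.
  rewrite /at_right !near_withinE => /nbhs_ballP[r /= r0 H].
  apply/nbhs_ballP; exists r => //= y xry xy.
  (* A point between y and the end of the neighbourhood: G y <= F z, and F z is within e of G x. *)
  pose z := (y + (x + r)) / 2.
  have yxr : y < x + r.
    by move: xry; rewrite /ball /= distrC gtr0_norm ?subr_gt0 //; lra.
  have yz : y < z by rewrite /z; lra.
  have zxr : z < x + r by rewrite /z; lra.
  have := H z; rewrite /ball /= distrC gtr0_norm ?subr_gt0; last lra.
  have zx : z - x < r by lra.
  move=> /(_ zx (lt_trans xy yz)).
  have h1 := GF _ _ yz; have h2 := Gnd _ _ (ltW xy); have h3 := FleG _ _ (lexx z).
  rewrite !ler_norml; lra.
have G0M x : 0 <= G x <= M.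
  have /andP[a _] := F0M x; have /andP[_ b] := F0M (x + 1).
  by rewrite (le_trans a) ?FleG // (le_trans (GF x (x + 1) _)) // ltrDl.
pose CG := isCumulative.Build R _ R G Gnd Grc.
pose cG : cumulative R R := HB.pack_for (cumulative R R) G CG.
pose lsm := lebesgue_stieltjes_measure cG.
have lsmE u v : u <= v -> lsm `]u, v]%classic = (G v - G u)%:E.
  move=> uv; rewrite /lsm /= /lebesgue_stieltjes_measure /measure_extension.
  by rewrite measurable_mu_extE /= ?wlength_itv_bnd //; exact: is_ocitv.
have lsmT : (lsm setT <= M%:E)%E.
  rewrite -(bigcup_itvT false false).
  pose I n : set R := `]- (n%:R), n%:R]%classic.
  have cvgI : (lsm \o I) n @[n --> \oo] --> lsm (\bigcup_n I n).
    apply: nondecreasing_cvg_mu; rewrite /I //; first exact: bigcup_measurable.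
    by move=> *; apply/subsetPset/subset_itv; rewrite leBSide /= ?lerN2 ler_nat.
  rewrite -(cvg_lim _ cvgI) //; apply: lime_le; first by apply/cvg_ex; eexists; exact: cvgI.
  apply: nearW => n; rewrite /= /I lsmE ?lee_fin; last by rewrite ge0_cp.
  by have /andP[a _] := G0M (- n%:R); have /andP[_ b] := G0M n%:R; lra.
have lsmfin : fin_num_fun lsm.
  apply: lty_fin_num_fun; exact: le_lt_trans lsmT (ltry _).
pose Cf := Measure_isFinite.Build _ _ _ lsm lsmfin.
pose mu : {finite_measure set (measurableTypeR R) -> \bar R} :=
  HB.pack_for {finite_measure set (measurableTypeR R) -> \bar R} lsm Cf.
exists mu => u v uv.
rewrite -[mu _]/(lsm `]u, v]%classic) lsmE //=.
have FGs x : F (x + d) @[d --> 0^'+] --> G x.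
  apply/cvgrPdist_le => e e0.
  have /cvgrPdist_le/(_ _ e0) := FG x.
  rewrite /at_right !near_withinE => /nbhs_ballP[r /= r0 H].
  apply/nbhs_ballP; exists r => //= d; rewrite /ball /= sub0r normrN => dr d0.
  apply: H; last by rewrite ltrDl.
  by rewrite /ball /= opprD addNKr normrN.
by apply: cvgB.
Qed.

(** * Approximation of monomials by step functions *)

Definition step_fun (R : realType) (K : nat) (u c : nat -> R) (x : R) : R :=
  \sum_(i < K) c i * \1_(`]u i, u i.+1]%classic) x.

(** The half-open pieces are disjoint, so a single term survives at each point. The vanishing
    outside carries the induction and later gives the estimate on the tails. *)
Lemma step_fun_approx (R : realType) (phi : R -> R) (K : nat) (u c : nat -> R)
    (e : R) :
  (forall i, u i <= u i.+1) ->
  (forall i x, (i < K)%N -> u i < x <= u i.+1 -> `|phi x - c i| <= e) ->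
  forall x, (u 0 < x <= u K -> `|phi x - step_fun K u c x| <= e) /\
            ((x <= u 0) || (u K < x) -> step_fun K u c x = 0).
Proof.
move=> und; elim: K => [_ x|K IH H x].
  split; last by rewrite /step_fun big_ord0.
  by case/andP => /lt_le_trans h /h; rewrite ltxx.
have u0K : u 0 <= u K by elim: (K) => // i /le_trans; apply.
have [IH1 IH2] := IH (fun i x iK => H i x (leqW iK)) x.
have sE : step_fun K.+1 u c x =
    step_fun K u c x + c K * \1_(`]u K, u K.+1]%classic) x.
  by rewrite /step_fun big_ord_recr.
rewrite sE indicE; split.
  case/andP => ux xK1.
  have [xK|Kx] := leP x (u K).
    rewrite memNset ?mulr0 ?addr0; first by apply: IH1; rewrite ux xK.
    by rewrite /= in_itv /= ltNge xK.
  rewrite mem_set /=; last by rewrite in_itv /= Kx.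
  by rewrite IH2 ?Kx ?orbT // add0r mulr1 H // Kx.
move=> /orP[xu|Kx].
  rewrite IH2 ?xu // memNset ?mulr0 ?addr0 //=.
  by rewrite in_itv /= ltNge (le_trans xu).
rewrite IH2 ?(le_lt_trans (und K) Kx) ?orbT // memNset ?mulr0 ?addr0 //=.
by rewrite in_itv /= leNgt Kx andbF.
Qed.

Lemma expr_lipschitz (R : realType) (n : nat) (B : R) : 0 <= B ->
  exists2 C, 0 <= C & forall x y, `|x| <= B -> `|y| <= B ->
    `|x ^+ n - y ^+ n| <= C * `|x - y|.
Proof.
move=> B0; elim: n => [|n [C C0 IH]].
  by exists 0 => // x y _ _; rewrite subrr normr0 mul0r.
exists (B * C + B ^+ n) => [|x y xB yB]; first by rewrite addr_ge0 ?mulr_ge0 ?exprn_ge0.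
have -> : x ^+ n.+1 - y ^+ n.+1 = x * (x ^+ n - y ^+ n) + (x - y) * y ^+ n.
  by rewrite !exprS; ring.
rewrite (le_trans (ler_normD _ _)) // !normrM mulrDl lerD //.
  by rewrite -mulrA ler_pM // IH.
by rewrite mulrC ler_wpM2r // normrX lerXn2r // nnegrE.
Qed.

(* Uniformity in the shift [d] is what lets the Stieltjes measure of a
   distribution function that is not right-continuous be compared with it. *)
Lemma expr_step_approx (R : realType) (n j : nat) :
  exists K (u c : nat -> R) h,
    [/\ 0 < h, forall i, u i <= u i.+1, ~~ odd n -> forall i, 0 <= c i &
        forall d x, 0 <= d -> d < h ->
          `|x ^+ n - step_fun K (fun i => u i + d) c x| <=
            j.+1%:R^-1 * (1 + x ^+ (2 * n.+1))].
Proof.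
(* One more than j+1, to absorb a shift d < h <= 1: outside the range of the shifted steps, |x| >=
   j+1. *)
pose N := j.+2.
have [C C0 CP] := @expr_lipschitz R n N.+1%:R (ler0n _ _).
(* A point of a shifted piece is within 2h of its unshifted left node, so the mesh h = 1/M must make
   2Ch at most 1/(j+1). *)
pose M := (Num.bound (2 * C * j.+1%:R)).+1.
have M0 : 0 < M%:R :> R by rewrite ltr0n.
pose h : R := M%:R^-1.
have h0 : 0 < h by rewrite invr_gt0.
have h1 : h <= 1 by rewrite invf_le1 // ler1n.
have MC : 2 * C * h <= j.+1%:R^-1.
  rewrite ler_pdivrMr // ler_pdivlMl ?ltr0n // mulrC.
  have /archi_boundP : 0 <= 2 * C * j.+1%:R by rewrite !mulr_ge0.
  by move=> /ltW /le_trans -> //; rewrite ler_nat.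
pose t i : R := - N%:R + i%:R * h.
have tnd i : t i <= t i.+1 by rewrite lerD2l ler_wpM2r // ?ler_nat // ltW.
have tK : t (2 * N * M)%N = N%:R.
  by rewrite /t !natrM -mulrA mulfV ?mulr1 ?lt0r_neq0 //; ring.
exists (2 * N * M)%N, t, (fun i => t i ^+ n), h; split => //.
  by move=> ne i; rewrite exprn_even_ge0.
move=> d x d0 dh.
have xe0 : 0 <= x ^+ (2 * n.+1) by rewrite exprM exprn_ge0 // sqr_ge0.
have [||H1 H2] := @step_fun_approx R (fun x => x ^+ n) (2 * N * M)%N
    (fun i => t i + d) (fun i => t i ^+ n) j.+1%:R^-1 _ _ x.
- by move=> i; rewrite lerD2r.
- move=> i y iK /andP[ty yt].
  have ti0 : - N%:R <= t i by rewrite lerDl mulr_ge0 // ltW.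
  have tiN : t i.+1 <= N%:R.
    rewrite -tK; elim: (2 * N * M)%N iK => // K IH; rewrite ltnS leq_eqVlt.
    by case/predU1P => [->//|/IH/le_trans]; apply.
  have tS : t i.+1 = t i + h by rewrite /t -natr1; ring.
  have NS : N.+1%:R = N%:R + 1 :> R by rewrite natr1.
  rewrite tS in yt tiN.
  apply: le_trans (CP _ _ _ _) _; rewrite ?NS ?ler_norml; [lra|lra|].
  apply: le_trans MC; rewrite mulrAC [leRHS]mulrC mulrA.
  rewrite [leRHS](_ : _ = C * (2 * h)); last by ring.
  by rewrite ler_wpM2l // ler_norml; lra.
rewrite tK in H1 H2.
have [/H1 h3|out] := boolP (t 0 + d < x <= N%:R + d).
  by rewrite (le_trans h3) // ler_pMr ?invr_gt0 ?ltr0n // lerDl.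
rewrite H2; last by move: out; rewrite negb_and -leNgt -ltNge.
rewrite subr0 ler_pdivlMl ?ltr0n //.
(* On the tails the approximant is 0 and the weight wins: (j+1)|x|^n <= |x|^(n+1) <= x^(2n+2). *)
have xj : j.+1%:R <= `|x|.
  have NS : N%:R = j.+1%:R + 1 :> R by rewrite natr1.
  have dlt1 := lt_le_trans dh h1.
  rewrite ler_normr; move: out; rewrite negb_and -leNgt -ltNge /t mul0r addr0 NS.
  by case/orP => ?; apply/orP; [right|left]; lra.
have x1 : 1 <= `|x| by rewrite (le_trans _ xj) // ler1n.
have e1 : j.+1%:R * `|x ^+ n| <= `|x| ^+ n.+1 by rewrite normrX exprS ler_wpM2r.
apply: le_trans e1 _; apply: (@le_trans _ _ (`|x| ^+ (2 * n.+1))).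
  by apply: ler_weXn2l => //; rewrite leq_pmull.
by rewrite exprM real_normK ?num_real // -exprM lerDr.
Qed.

(** * The functional on polynomials defined by a moment sequence *)

Definition moment_form (R : realType) (t : nat -> R) (p : {poly R}) : R :=
  \sum_(i < size p) p`_i * t i.

Lemma moment_formE (R : realType) (t : nat -> R) (p : {poly R}) N :
  (size p <= N)%N -> moment_form t p = \sum_(i < N) p`_i * t i.
Proof.
move=> pN; rewrite /moment_form (big_ord_widen _ (fun i => p`_i * t i) pN).
rewrite big_mkcond; apply: eq_bigr => i _; case: ifPn => // /[!ltnNge] /negPn pi.
by rewrite nth_default // mul0r.
Qed.

Lemma moment_form_linear (R : realType) (t : nat -> R) (p q : {poly R}) c :
  moment_form t (p + c *: q) = moment_form t p + c * moment_form t q.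
Proof.
rewrite (@moment_formE _ _ _ (maxn (size p) (size q))); last first.
  rewrite (leq_trans (size_polyD _ _)) // geq_max leq_maxl.
  by rewrite (leq_trans (size_scale_leq _ _)) // leq_maxr.
rewrite (@moment_formE _ _ p _ (leq_maxl _ (size q))).
rewrite (@moment_formE _ _ q _ (leq_maxr (size p) _)) big_distrr -big_split /=.
by apply: eq_bigr => i _; rewrite !coefE; ring.
Qed.

Lemma moment_form0 (R : realType) (t : nat -> R) : moment_form t 0 = 0.
Proof. by rewrite /moment_form size_poly0 big_ord0. Qed.

Lemma moment_formD (R : realType) (t : nat -> R) (p q : {poly R}) :
  moment_form t (p + q) = moment_form t p + moment_form t q.
Proof. by have := moment_form_linear t p q 1; rewrite scale1r mul1r. Qed.

Lemma moment_formXn (R : realType) (t : nat -> R) n : moment_form t 'X^n = t n.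
Proof.
rewrite /moment_form size_polyXn big_ord_recr /= coefXn eqxx mul1r big1 ?add0r //.
by move=> i _; rewrite coefXn ltn_eqF ?mul0r.
Qed.

Definition hankel_nonneg (R : realType) (t : nat -> R) :=
  forall A : {poly R}, 0 <= moment_form t (A ^+ 2).

Lemma cvg_harmonic_bound (R : realType) (a C : R) (s : nat -> R) :
  (forall j, `|a - s j| <= j.+1%:R^-1 * C) -> s @ \oo --> a.
Proof.
move=> H.
have hC : (fun j => j.+1%:R^-1 * C) @ \oo --> (0 : R).
  by rewrite -(mul0r C); apply: cvgM; [exact: cvg_harmonic|exact: cvg_cst].
apply: (@squeeze_cvgr _ _ _ _ (fun j => a - j.+1%:R^-1 * C)
                              (fun j => a + j.+1%:R^-1 * C)).
- by apply: nearW => j; have := H j; rewrite distrC ler_distl.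
- by rewrite -[X in _ --> X]subr0; apply: cvgB => //; exact: cvg_cst.
- by rewrite -[X in _ --> X]addr0; apply: cvgD => //; exact: cvg_cst.
Qed.

Lemma integrable_step_fun (R : realType)
    (mu : {finite_measure set (measurableTypeR R) -> \bar R}) K u c :
  rintegrable mu (step_fun K u c) /\
  rintegral mu (step_fun K u c) =
    \sum_(i < K) c i * fine (mu `]u i, u i.+1]%classic).
Proof.
have I i : rintegrable mu (\1_(`]u i, u i.+1]%classic) : R -> R).
  exact: integrable_indic.
have E i : rintegral mu (\1_(`]u i, u i.+1]%classic) : R -> R) =
    fine (mu `]u i, u i.+1]%classic).
  by rewrite /rintegral /Rintegral integral_indic // setIT.
split; first by apply: rintegrable_sum => i _; exact: rintegrableZ.
rewrite rintegral_sum => [|i _]; last exact: rintegrableZ.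
by apply: eq_bigr => i _; rewrite rintegralZ ?E.
Qed.

(** Monomials differ from step functions by at most (1 + x^(2n+2))/(j+1). This error weight is
    itself a polynomial, so positivity of the extended functional controls the error before any
    integrability with respect to the measure is known. *)
Theorem hamburger (R : realType) (t : nat -> R) : hankel_nonneg t ->
  exists mu : {finite_measure set (measurableTypeR R) -> \bar R},
    forall n, rintegrable mu (fun x => x ^+ n) /\
              rintegral mu (fun x : R => x ^+ n) = t n.
Proof.
move=> tpos.
pose G0 := [set q : (R -> R) * R | exists p : {poly R},
  q = (fun x => p.[x], moment_form t p)].
have [|||G [G0G Glin Gpos Gdom]] := @riesz_extension R R G0.
- exists 0; rewrite moment_form0; congr pair.
  by apply/funext => x; rewrite horner0.
- move=> f r g s c [p [-> ->]] [q [-> ->]]; exists (p + c *: q).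
  rewrite moment_form_linear; congr pair.
  by apply/funext => x; rewrite !hornerE.
- move=> f r [p [-> ->]] /nonneg_poly_sum_two_squares[A [B ->]].
  by rewrite moment_formD addr_ge0.
have Gle f g r s : G (f, r) -> G (g, s) -> (forall x, f x <= g x) -> r <= s.
  move=> Gf Gg fg; have := Gpos _ _ (Glin _ _ _ _ (-1) Gg Gf).
  by rewrite mulN1r subr_ge0; apply => x; rewrite mulN1r subr_ge0.
have Gzero : G0 (fun=> 0, 0).
  exists 0; rewrite moment_form0; congr pair.
  by apply/funext => x; rewrite horner0.
have Gone : G0 (fun=> 1, t 0).
  exists 1; rewrite -(expr0 'X) moment_formXn; congr pair.
  by apply/funext => x; rewrite hornerXn expr0.
have Gmono n : G (fun x => x ^+ n, t n).
  apply: G0G; exists 'X^n; rewrite moment_formXn; congr pair.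
  by apply/funext => x; rewrite hornerXn.
have /choice[F GF] : forall s : R, exists r, G (fun x => (x <= s)%R%:R, r).
  by move=> s; apply: (Gdom _ _ _ _ _ Gzero Gone) => x; case: (x <= s).
have Fnd : {homo F : x y / x <= y}.
  move=> x y xy; apply: Gle (GF x) (GF y) _ => z.
  by rewrite ler_nat; case: (leP z x) => // /le_trans/(_ xy) ->.
have F01 x : 0 <= F x <= t 0.
  by rewrite (Gle _ _ _ _ (G0G _ Gzero) (GF x)) ?(Gle _ _ _ _ (GF x) (G0G _ Gone)) //
    => y; case: (y <= x).
have [mu muP] := stieltjes_of_monotone Fnd F01.
exists mu.
have Gstep K (u c : nat -> R) : (forall i, u i <= u i.+1) ->
    G (step_fun K u c, \sum_(i < K) c i * (F (u i.+1) - F (u i))).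
  move=> und; elim: K => [|K IH].
    rewrite big_ord0 (_ : step_fun _ _ _ = fun=> 0); first exact: G0G.
    by apply/funext => x; rewrite /step_fun big_ord0.
  have := Glin _ _ _ _ (c K) IH (Glin _ _ _ _ (-1) (GF (u K.+1)) (GF (u K))).
  congr (G (_, _)); last by rewrite big_ord_recr /= mulN1r.
  apply/funext => x; rewrite /step_fun big_ord_recr /= indicE mulN1r; congr (_ + _ * _).
  case: (leP x (u K)) => [xu|ux].
    by rewrite (le_trans xu (und K)) subrr memNset //= in_itv /= ltNge xu.
  case: (leP x (u K.+1)) => xu; rewrite subr0.
    by rewrite mem_set //= in_itv /= ux.
  by rewrite memNset //= in_itv /= ux leNgt xu.
(* The value of the functional on the error weight 1 + x^(2n+2). *)
pose B n : R := t 0 + t (2 * n.+1)%N.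
have approx n j : exists s : R -> R,
    [/\ rintegrable mu s,
        `|t n - rintegral mu s| <= j.+1%:R^-1 * B n,
        ~~ odd n -> forall x, 0 <= s x &
        forall x, `|x ^+ n - s x| <= j.+1%:R^-1 * (1 + x ^+ (2 * n.+1))].
  have [K [u [c [h [h0 und c0 H]]]]] := @expr_step_approx R n j.
  have [iS eS] := integrable_step_fun mu K u c.
  exists (step_fun K u c); split => //.
  (* The extended functional at the step function shifted by d. It tends to the integral as d
     decreases to 0, because [mu] comes from right limits of [F]. *)
  - pose S d := \sum_(i < K) c i * (F (u i.+1 + d) - F (u i + d)).
    have cS : S d @[d --> 0^'+] --> rintegral mu (step_fun K u c).
      rewrite eS; apply: cvg_big => [|i _]; first exact: add_continuous.
      by apply: cvgM; [exact: cvg_cst|exact: muP].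
    have cS' : `|t n - S d| @[d --> 0^'+] -->
        `|t n - rintegral mu (step_fun K u c)|.
      by apply: cvg_norm; apply: cvgB => //; exact: cvg_cst.
    rewrite -(cvg_lim _ cS') //.
    apply: limr_le; first by apply/cvg_ex; eexists; exact: cS'.
    near=> d.
    have d0 : 0 <= d by near: d; apply: nbhs_right_ge.
    have dh : d < h by near: d; apply: nbhs_right_lt.
    have Gd : G (step_fun K (fun i => u i + d) c, S d).
      by apply: Gstep => i; rewrite lerD2r.
    have Gn := Glin _ _ _ _ (-1) (Gmono n) Gd.
    have Gw := Glin _ _ _ _ j.+1%:R^-1 (G0G _ Gzero)
      (Glin _ _ _ _ 1 (G0G _ Gone) (Gmono (2 * n.+1)%N)).
    have Gw' := Glin _ _ _ _ (-1) (G0G _ Gzero) Gw.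
    have Hd x := H d x d0 dh.
    rewrite ler_norml -(mulN1r (S d)); apply/andP; split.
      have := Gle _ _ _ _ Gw' Gn; rewrite /B !mul1r !add0r !mulN1r; apply=> x.
      by have := Hd x; rewrite ler_norml !mul1r !add0r !mulN1r => /andP[].
    have := Gle _ _ _ _ Gn Gw; rewrite /B !mul1r !add0r !mulN1r; apply=> x.
    by have := Hd x; rewrite ler_norml !mul1r !add0r !mulN1r => /andP[].
  - move=> ne x; rewrite /step_fun sumr_ge0 // => i _.
    by rewrite mulr_ge0 ?c0 // indicE; case: (_ \in _).
  - move=> x; have := H 0 x (lexx _) h0.
    by under [X in step_fun _ X]eq_fun do rewrite addr0.
have cvg_step n s : (forall j (x : R), `|x ^+ n - s j x| <= j.+1%:R^-1 * (1 + x ^+ (2 * n.+1))) ->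
    forall x, s j x @[j --> \oo] --> x ^+ n.
  by move=> H x; apply: (@cvg_harmonic_bound _ _ (1 + x ^+ (2 * n.+1))) => j.
have B0 n : 0 <= B n.
  have [s [_ + _ _]] := approx n 0%N.
  by rewrite invr1 mul1r; apply: le_trans.
(* For even n the approximants are nonnegative and have bounded integrals, as Fatou requires. *)
have int_even n : ~~ odd n -> rintegrable mu (fun x => x ^+ n).
  move=> ne; have /choice[s sP] := approx n.
  apply: (proj1 (@rintegrable_fatou _ mu s (fun x => x ^+ n) (t n + B n) _ _ _ _ _)).
  - by move=> j; have [] := sP j.
  - by move=> j x; have [_ _ /(_ ne x)] := sP j.
  - exact: exprn_measurable.
  - by apply: cvg_step => j x; have [] := sP j.
  - move=> j; have [_ + _ _] := sP j; rewrite ler_distlC => /andP[_ /le_trans]; apply.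
    by rewrite lerD2l ler_piMl // invf_le1 ?ler1n ?ltr0n.
have int_all n : rintegrable mu (fun x => x ^+ n).
  apply: (@rintegrable_le _ _ _ (fun x => 1 + x ^+ (2 * n))).
  - exact: exprn_measurable.
  - move=> x; rewrite mulnC exprM -[_ ^+ 2]real_normK ?num_real //.
    by have : 0 <= `|x ^+ n| by []; nra.
  - apply: rintegrableD; first exact: rintegrable_cst.
    by apply: int_even; rewrite oddM.
move=> n; split => //.
have /choice[s sP] := approx n.
have c1 : rintegral mu (s j) @[j --> \oo] --> t n.
  by apply: (@cvg_harmonic_bound _ _ (B n)) => j; have [] := sP j.
(* The error weight has even degree, so it is now integrable, and the same approximants also
   converge to the integral of x^n. *)
suff c2 : rintegral mu (s j) @[j --> \oo] --> rintegral mu (fun x => x ^+ n).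
  exact: cvg_unique c2 c1.
have iw : rintegrable mu (fun x => 1 + x ^+ (2 * n.+1)).
  by apply: rintegrableD => //; exact: rintegrable_cst.
apply: (@cvg_harmonic_bound _ _ (rintegral mu (fun x => 1 + x ^+ (2 * n.+1)))).
move=> j; have [sI _ _ sB] := sP j.
rewrite -rintegralB // -rintegralZ //.
by apply: rintegral_norm_le => //; [exact: rintegrableB|exact: rintegrableZ].
Unshelve. all: by end_near. Qed.

(** * From exponential convexity to positivity on squares *)

(** Convergence at r bounds the terms there, so for |y| <= r/2 they are dominated by a geometric
    sequence of ratio at most 1/2. *)
Lemma pseries_remainder (R : realType) (c : nat -> R) (r : R) K :
  0 < r -> cvgn (pseries c r) ->
  exists2 C : R, 0 <= C & forall y l : R, `|y| <= r / 2 -> pseries c y @ \oo --> l ->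
    `|l - \sum_(p < K) c p * y ^+ p| <= C * `|y| ^+ K.
Proof.
move=> r0 cr.
have [B [B0 BP]] : exists B : R, 0 <= B /\ forall p, `|c p * r ^+ p| <= B.
  have [M [_ Mc]] := cvg_series_bounded cr.
  have BP p : `|c p * r ^+ p| <= M + 1 by apply: Mc => //; rewrite ltrDl.
  by exists (M + 1); split => //; exact: le_trans (BP 0%N).
exists (2 * B / r ^+ K) => [|y l yr yl]; first by rewrite divr_ge0 ?mulr_ge0 ?exprn_ge0 // ltW.
pose q := `|y| / r.
have q0 : 0 <= q by rewrite divr_ge0 // ltW.
have q2 : q <= 1 / 2 by rewrite ler_pdivrMr // mulrC mulrA mulr1.
have cq p : `|c p * y ^+ p| <= B * q ^+ p.
  have -> : `|c p * y ^+ p| = `|c p * r ^+ p| * q ^+ p.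
    rewrite !normrM !normrX /q expr_div_n (gtr0_norm r0).
    by rewrite -!mulrA; congr (_ * _); rewrite mulrCA mulfV ?mulr1 // expf_neq0 // gt_eqF.
  by rewrite ler_wpM2r // exprn_ge0.
(* The subtracted term makes the bound inductive: as 2q <= 1, it drops at each step by at least B
   q^(K+n), the bound on the new term. *)
have part n : `|\sum_(p < K + n) c p * y ^+ p - \sum_(p < K) c p * y ^+ p| <=
    2 * B * q ^+ K - 2 * B * q ^+ (K + n).
  elim: n => [|n IH]; first by rewrite addn0 !subrr normr0.
  rewrite addnS big_ord_recr /= -addrAC (le_trans (ler_normD _ _)) //.
  apply: le_trans (lerD IH (cq _)) _.
  have := exprn_ge0 (K + n) q0; rewrite exprS; move: (q ^+ (K + n)) => Q Q0.
  have : 0 <= B * Q * (1 - 2 * q) by rewrite !mulr_ge0 //; lra.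
  by lra.
have -> : 2 * B / r ^+ K * `|y| ^+ K = 2 * B * q ^+ K.
  by rewrite /q expr_div_n; ring.
have cv : `|pseries c y (n + K)%N - \sum_(p < K) c p * y ^+ p| @[n --> \oo] -->
    `|l - \sum_(p < K) c p * y ^+ p|.
  apply: cvg_norm; apply: cvgB; last exact: cvg_cst.
  by rewrite cvg_shiftn.
rewrite -(cvg_lim _ cv) //; apply: limr_le; first by apply/cvg_ex; eexists; exact: cv.
apply: nearW => n; rewrite /pseries /series /= big_mkord addnC (le_trans (part n)) //.
by rewrite gerBl !mulr_ge0 ?exprn_ge0.
Qed.

(** The columns of the inverse Vandermonde matrix at the distinct nodes 0, ..., K-1, extended by 0
    to indices out of range. *)
Lemma dual_monomial_weights (R : realType) K : exists g : nat -> nat -> R,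
  forall e i, (e < K)%N -> (i < K)%N ->
    \sum_(m < K) m%:R ^+ e * g m i = (e == i)%:R.
Proof.
pose V : 'M[R]_K := Vandermonde K (\row_j (j : nat)%:R).
have Vu : V \in unitmx.
  rewrite unitmxE det_Vandermonde unitfE.
  apply/prodf_neq0 => i _; apply/prodf_neq0 => j ij.
  by rewrite !mxE subr_eq0 eqr_nat gtn_eqF.
exists (fun m i => if insub m is Some m' then
  if insub i is Some i' then invmx V m' i' else 0 else 0).
move=> e i eK iK.
have := congr1 (fun A : 'M[R]_K => A (Ordinal eK) (Ordinal iK)) (mulmxV Vu).
rewrite !mxE -val_eqE /= => <-; apply: eq_bigr => m _.
by rewrite !mxE valK insubT.
Qed.

(* The weights are scaled by [h ^ d] so that no negative power of [h] occurs. *)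
Lemma moment_form_sqrE (R : realType) (t : nat -> R) (A : {poly R}) (h : R)
    (f : nat -> R) :
  let d := size A in let K := (d + d)%N in
  (forall e, (e < K)%N ->
     \sum_(m < K) f m * m%:R ^+ e = A`_e * e`!%:R * h ^+ (d - e)) ->
  \sum_(m < K) \sum_(l < K) (\sum_(p < K)
     t p / p`!%:R * ((m + l)%:R * h) ^+ p) * (f m * f l) =
  h ^+ K * moment_form t (A ^+ 2).
Proof.
move=> d K fE.
have sA2 : (size (A ^+ 2) <= K)%N.
  by rewrite expr2 (leq_trans (size_polyMleq _ _)) // leq_pred.
rewrite (moment_formE t sA2) big_distrr /=.
under eq_bigr => m _ do under eq_bigr => l _ do rewrite big_distrl /=.
under eq_bigr => m _ do rewrite exchange_big /=.
rewrite exchange_big /=; apply: eq_bigr => p _.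
(* The binomial theorem for (m + l)^p separates m from l and leaves products of power sums of [f],
   which [fE] evaluates. *)
transitivity (t p / p`!%:R * h ^+ p * \sum_(q < p.+1) 'C(p, q)%:R *
   ((\sum_(m < K) f m * m%:R ^+ (p - q)) * (\sum_(l < K) f l * l%:R ^+ q))).
  rewrite big_distrr /=.
  under [RHS]eq_bigr => q _ do rewrite big_distrl big_distrr big_distrr /=.
  rewrite [RHS]exchange_big /=; apply: eq_bigr => m _.
  under [RHS]eq_bigr => q _ do rewrite big_distrr big_distrr big_distrr /=.
  rewrite [RHS]exchange_big /=; apply: eq_bigr => l _.
  rewrite natrD exprMn exprDn big_distrl big_distrr big_distrl /=.
  by apply: eq_bigr => q _; rewrite -mulr_natl; ring.
rewrite expr2 coefM big_distrl !big_distrr /=; apply: eq_bigr => q _.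
have qp : (q <= p)%N by rewrite -ltnS.
have pK := ltn_ord p.
rewrite !fE ?(leq_ltn_trans _ pK) ?leq_subr //.
(* From degree d on the coefficients of [A] vanish; in the remaining terms no subtraction in an
   exponent is truncated. *)
have [dq|qd] := leqP d q.
  by rewrite (nth_default _ dq) !(mul0r, mulr0).
have [dpq|pqd] := leqP d (p - q).
  by rewrite (nth_default _ dpq) !(mul0r, mulr0).
have -> : h ^+ K = h ^+ p * h ^+ (d - (p - q)) * h ^+ (d - q).
  have e (a b c : nat) : (b <= a)%N -> (b < c)%N -> (a - b < c)%N ->
    (c + c = a + (c - (a - b)) + (c - b))%N by lia.
  by rewrite -!exprD -e.
rewrite -(bin_fact qp) !natrM.
have f1 : q`!%:R != 0 :> R by rewrite pnatr_eq0 -lt0n fact_gt0.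
have f2 : (p - q)`!%:R != 0 :> R by rewrite pnatr_eq0 -lt0n fact_gt0.
have f3 : 'C(p, q)%:R != 0 :> R by rewrite pnatr_eq0 -lt0n bin_gt0.
by field; rewrite f1 f2 f3.
Qed.

(** The weights used are a finite-difference form of h^d A(D) at 0, with D the derivative. Applied
    in both variables to k(x + y) they give h^(2d) times the functional at A^2, up to a Taylor
    remainder; after division by h^(2d) the error is of order h. *)
Lemma hankel_nonneg_of_kernel (R : realType) (t : nat -> R) (a : R)
    (k : R -> R) : 0 < a ->
  (forall y, `|y| < a -> pseries (fun n => t n / n`!%:R) y @ \oo --> k y) ->
  (forall N (c x : nat -> R), (forall i, `|x i| < a / 2) ->
     0 <= \sum_(i < N) \sum_(j < N) k (x i + x j) * (c i * c j)) ->
  hankel_nonneg t.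
Proof.
move=> a0 kE kpos A.
pose d := size A; pose K := (d + d)%N.
have [g gP] := dual_monomial_weights R K.
pose f h m := \sum_(e < K) A`_e * e`!%:R * h ^+ (d - e) * g m e.
have fE h e : (e < K)%N ->
    \sum_(m < K) f h m * m%:R ^+ e = A`_e * e`!%:R * h ^+ (d - e).
  move=> eK; rewrite /f.
  under eq_bigr => m _ do rewrite big_distrl /=.
  rewrite exchange_big /=.
  transitivity (\sum_(i < K) A`_i * i`!%:R * h ^+ (d - i) * (e == i)%:R).
    apply: eq_bigr => i _; rewrite -gP // big_distrr /=.
    by apply: eq_bigr => m _; ring.
  rewrite (bigD1 (Ordinal eK)) //= eqxx mulr1 big1 ?addr0 // => i ie.
  by rewrite eq_sym -[_ == _ :> nat]/(i == Ordinal eK) (negbTE ie) mulr0.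
(* Only e < d contributes, so every weight carries a factor h. This is the gain over the Taylor
   remainder, which alone is only of order h^K. *)
have [M M0 fM] : exists2 M : R, 0 <= M &
    forall h m, (m < K)%N -> 0 < h <= 1 -> `|f h m| <= M * h.
  exists (\sum_(m < K) \sum_(e < K) `|A`_e * e`!%:R * g m e|).
    by rewrite sumr_ge0 // => m _; rewrite sumr_ge0.
  move=> h m mK /andP[h0 h1].
  rewrite (bigD1 (Ordinal mK)) //= mulrDl ler_wpDr //.
    by rewrite mulr_ge0 ?(ltW h0) // sumr_ge0 // => i _; rewrite sumr_ge0.
  rewrite (le_trans (ler_norm_sum _ _ _)) // big_distrl /= ler_sum // => e _.
  have [de|ed] := leqP d e.
    by rewrite (nth_default _ de) !mul0r normr0 mul0r.
  rewrite mulrAC normrM ler_wpM2l // normrX gtr0_norm //.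
  by rewrite -[leRHS]expr1 ler_wiXn2l // ?ltW // subn_gt0.
have a2 : 0 < a / 2 by rewrite divr_gt0.
have ca : cvgn (pseries (fun n => t n / n`!%:R) (a / 2)).
  apply/cvg_ex; exists (k (a / 2)); apply: kE.
  by rewrite gtr0_norm //; lra.
have [C C0 CP] := pseries_remainder K a2 ca.
rewrite leNgt; apply/negP => mneg.
(* There are K^2 pairs, each with Taylor error C (2Kh)^K and a product of weights at most M^2 h; the
   factor h^K h is taken out. *)
pose E := C * (2 * K%:R) ^+ K * M ^+ 2 * K%:R * K%:R.
have E0 : 0 <= E by rewrite !mulr_ge0 ?exprn_ge0.
have main (h : R) : 0 < h <= 1 -> 2 * K%:R * h < a / 2 / 2 ->
    - (E * h) <= moment_form t (A ^+ 2).
  move=> h01 hK; have /andP[h0 h1] := h01.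
  (* The hypothesis constrains the points at all indices, whence the default 0 from K on. *)
  pose x i : R := if (i < K)%N then i%:R * h else 0.
  have x0K i : 0 <= x i <= K%:R * h.
    rewrite /x; case: ifPn => iK; last by rewrite lexx mulr_ge0 // ltW.
    by rewrite mulr_ge0 ?(ltW h0) //= ler_wpM2r ?(ltW h0) // ler_nat ltnW.
  have xa i : `|x i| < a / 2.
    by have /andP[l u] := x0K i; rewrite ger0_norm //; lra.
  pose p i j : R := \sum_(p < K) t p / p`!%:R * (x i + x j) ^+ p.
  have remE i j : (i < K)%N -> (j < K)%N ->
      k (x i + x j) * (f h i * f h j) <=
      p i j * (f h i * f h j) + h ^+ K * (C * (2 * K%:R) ^+ K * M ^+ 2 * h).
    move=> iK jK; rewrite -lerBlDl -mulrBl (le_trans (ler_norm _)) // normrM.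
    have /andP[l u] := x0K i; have /andP[l' u'] := x0K j.
    have b1 : `|k (x i + x j) - p i j| <= C * (2 * K%:R * h) ^+ K.
      have xx : `|x i + x j| <= 2 * K%:R * h by rewrite ger0_norm ?addr_ge0 //; lra.
      apply: le_trans (CP _ _ _ _) _; first by rewrite (le_trans xx) // ltW.
        by apply: kE; rewrite (le_lt_trans xx) //; lra.
      by rewrite ler_wpM2l // lerXn2r // nnegrE (le_trans _ xx).
    have b2 : `|f h i * f h j| <= M ^+ 2 * h.
      rewrite normrM (@le_trans _ _ ((M * h) * (M * h))) //.
        by rewrite ler_pM // fM.
      rewrite [leLHS](_ : _ = M ^+ 2 * h * h); last by ring.
      by rewrite ler_piMr // mulr_ge0 ?exprn_ge0 // ltW.
    apply: le_trans (ler_pM _ _ b1 b2) _ => //.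
    by rewrite exprMn le_eqVlt; apply/orP; left; apply/eqP; ring.
  have := kpos K (f h) x xa.
  have -> : moment_form t (A ^+ 2) =
      h ^- K * \sum_(i < K) \sum_(j < K) p i j * (f h i * f h j).
    rewrite (_ : \sum_(i < K) _ = h ^+ K * moment_form t (A ^+ 2)).
      by rewrite mulKf // expf_neq0 // gt_eqF.
    rewrite -(moment_form_sqrE t (fE h)); apply: eq_bigr => i _; apply: eq_bigr => j _.
    congr (_ * _); apply: eq_bigr => q _; congr (_ * _ ^+ _).
    by rewrite /x !ltn_ord natrD mulrDl.
  move=> pos; rewrite ler_pdivlMl ?exprn_gt0 //.
  suff : \sum_(i < K) \sum_(j < K) k (x i + x j) * (f h i * f h j) <=
     \sum_(i < K) \sum_(j < K) p i j * (f h i * f h j) + h ^+ K * (E * h).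
    by rewrite mulrN; lra.
  have -> : h ^+ K * (E * h) = \sum_(i < K) \sum_(j < K)
      h ^+ K * (C * (2 * K%:R) ^+ K * M ^+ 2 * h).
    rewrite sumr_const card_ord sumr_const card_ord.
    by rewrite -(mulr_natr (_ *+ K)) -(mulr_natr (h ^+ K * _)) /E; ring.
  rewrite -big_split /= ler_sum // => i _; rewrite -big_split /= ler_sum // => j _.
  exact: remE.
set m := moment_form _ _ in mneg main.
near (0 : R)^'+ => h.
have h0 : 0 < h by near: h; exact: nbhs_right_gt.
have h1 : h <= 1 by near: h; exact: nbhs_right_le.
have hK : h < a / 2 / 2 / (2 * K%:R + 1).
  by near: h; apply: nbhs_right_lt; rewrite divr_gt0 ?ltr_wpDl //; lra.
have hm : h < - m / (E + 1).
  by near: h; apply: nbhs_right_lt; rewrite divr_gt0 ?ltr_wpDl // oppr_gt0.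
have := main h; rewrite h0 h1 => /(_ isT).
rewrite ltr_pdivlMr ?ltr_wpDl // in hK; rewrite ltr_pdivlMr ?ltr_wpDl // in hm.
have : 0 <= h * E by rewrite mulr_ge0 // ltW.
have : 2 * K%:R * h < a / 2 / 2 by lra.
by move=> /[swap] ? /[swap] /[apply]; lra.
Unshelve. all: by end_near. Qed.

(** * Exponential moments *)

Section ExponentialMoments.
Context {R : realType} (mu : {finite_measure set (measurableTypeR R) -> \bar R}).

Definition exp_moment (x : R) (n : nat) : R :=
  rintegral mu (fun t => t ^+ n * expR (x * t)).

(** For r >= 0 this is comparable to e^((x-r)t) + e^((x+r)t): its integrability means finite
    exponential moments on the closed interval from x - r to x + r. *)
Definition exp_weight (x r t : R) : R := expR (x * t) * expR (r * `|t|).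

Lemma measurable_exprM_expR n x :
  measurable_fun setT (fun t : R => t ^+ n * expR (x * t)).
Proof.
apply: measurable_funM; first exact: exprn_measurable.
apply: measurableT_comp; first exact: measurable_expR.
by apply: measurable_funM.
Qed.

Lemma measurable_expRMl x : measurable_fun setT (fun t : R => expR (x * t)).
Proof.
apply: measurableT_comp; first exact: measurable_expR.
by apply: measurable_funM.
Qed.

Lemma measurable_exp_weight x r : measurable_fun setT (exp_weight x r).
Proof.
apply: measurable_funM; first exact: measurable_expRMl.
apply: measurableT_comp; first exact: measurable_expR.
by apply: measurable_funM => //; exact: measurableT_comp.
Qed.

Lemma exp_weight_le x y r s t : `|y - x| + s <= r ->
  exp_weight y s t <= exp_weight x r t.
Proof.
move=> h; rewrite /exp_weight -!expRD ler_expR.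
have -> : y * t = x * t + (y - x) * t by ring.
rewrite -addrA lerD2l; apply: (@le_trans _ _ ((`|y - x| + s) * `|t|)).
  by rewrite [leRHS]mulrDl lerD2r (le_trans (ler_norm _)) // normrM.
by rewrite ler_wpM2r.
Qed.

Lemma rintegrable_exp_weight x y r s : `|y - x| + s <= r ->
  rintegrable mu (exp_weight x r) -> rintegrable mu (exp_weight y s).
Proof.
move=> h; apply: rintegrable_le; first exact: measurable_exp_weight.
by move=> t; rewrite ger0_norm ?exp_weight_le // mulr_ge0 // expR_ge0.
Qed.

(** A single term of the exponential series at ru is at most its sum. *)
Lemma exprn_le_expR (r u : R) n : 0 < r -> 0 <= u ->
  u ^+ n <= n`!%:R / r ^+ n * expR (r * u).
Proof.
move=> r0 u0; have ru : 0 <= r * u by rewrite mulr_ge0 // ltW.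
have : (r * u) ^+ n / n`!%:R <= expR (r * u).
  case: n => [|n]; first by rewrite expr0 fact0 divr1 -[leLHS]expR0 ler_expR.
  by apply: le_trans (expR_ge1Dxn n ru); rewrite lerDr.
rewrite exprMn ler_pdivrMr ?ltr0n ?fact_gt0 // => h.
rewrite mulrAC ler_pdivlMr ?exprn_gt0 // mulrC [leRHS]mulrC.
exact: h.
Qed.

Lemma rintegrable_exp_moment x r n : 0 < r -> rintegrable mu (exp_weight x r) ->
  rintegrable mu (fun t => t ^+ n * expR (x * t)).
Proof.
move=> r0 /(rintegrableZ (n`!%:R / r ^+ n)).
apply: rintegrable_le; first exact: measurable_exprM_expR.
move=> t; rewrite normrM normrX (ger0_norm (expR_ge0 _)) /exp_weight.
rewrite [leRHS](_ : _ = n`!%:R / r ^+ n * expR (r * `|t|) * expR (x * t)); last by ring.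
by rewrite ler_wpM2r ?expR_ge0 // exprn_le_expR.
Qed.

Lemma exp_series_cvg (x : R) : series (exp_coeff x) @ \oo --> expR x.
Proof. by rewrite /expR; exact: is_cvg_series_exp_coeff. Qed.

Lemma exp_series_norm_le (x : R) n : `|series (exp_coeff x) n| <= expR `|x|.
Proof.
apply: (@le_trans _ _ (series (exp_coeff `|x|) n)).
  rewrite /series /= (le_trans (ler_norm_sum _ _ _)) // ler_sum // => i _.
  by rewrite /exp_coeff /= normrM normrX normfV (ger0_norm (ler0n _ _)).
apply: nondecreasing_cvgn_le; last exact: is_cvg_series_exp_coeff.
apply/nondecreasing_seqP => m; rewrite seriesSr lerDl.
by rewrite /exp_coeff divr_ge0 ?exprn_ge0.
Qed.

Lemma rintegral_exp_series x h n :
  (forall n, rintegrable mu (fun t => t ^+ n * expR (x * t))) ->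
  rintegrable mu (fun t => expR (x * t) * series (exp_coeff (h * t)) n) /\
  rintegral mu (fun t => expR (x * t) * series (exp_coeff (h * t)) n) =
    pseries (fun n => exp_moment x n / n`!%:R) h n.
Proof.
move=> xi.
have -> : (fun t => expR (x * t) * series (exp_coeff (h * t)) n) =
    (fun t => \sum_(0 <= i < n) h ^+ i / i`!%:R * (t ^+ i * expR (x * t))).
  apply/funext => t; rewrite /series /= big_distrr /=; apply: eq_bigr => i _.
  by rewrite /exp_coeff /= exprMn; ring.
split; first by apply: rintegrable_sum => i _; exact: rintegrableZ.
rewrite rintegral_sum => [|i _]; last exact: rintegrableZ.
apply: eq_bigr => i _; by rewrite rintegralZ // -[rintegral _ _]/(exp_moment x i) /=; ring.
Qed.

(** The partial sums of the exponential series at ht are bounded by e^(r|t|), so the weight itself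
    dominates and integration is termwise. *)
Lemma exp_moment_pseries x r h : 0 < r -> `|h| <= r ->
  rintegrable mu (exp_weight x r) ->
  pseries (fun n => exp_moment x n / n`!%:R) h @ \oo --> exp_moment (x + h) 0.
Proof.
move=> r0 hr wi.
have xi n := rintegrable_exp_moment n r0 wi.
have E n := rintegral_exp_series h n xi.
have -> : pseries (fun n => exp_moment x n / n`!%:R) h =
    (fun n => rintegral mu (fun t => expR (x * t) * series (exp_coeff (h * t)) n)).
  by apply/funext => n; rewrite (proj2 (E n)).
apply: (proj2 (@rintegral_dominated _ mu
  (fun n t => expR (x * t) * series (exp_coeff (h * t)) n)
  (fun t => t ^+ 0 * expR ((x + h) * t)) (exp_weight x r)
  (fun n => rintegrable_measurable (proj1 (E n)))
  (measurable_exprM_expR _ _) _ wi _)).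
- move=> t; rewrite expr0 mul1r mulrDl expRD.
  by apply: cvgM; [exact: cvg_cst|exact: exp_series_cvg].
- move=> n t; rewrite normrM (ger0_norm (expR_ge0 _)) ler_wpM2l ?expR_ge0 //.
  by rewrite (le_trans (exp_series_norm_le _ _)) // ler_expR normrM ler_wpM2r.
Qed.

(** In the sum of the expansions at r and -r the odd terms cancel and the even ones are nonnegative,
    so Fatou applies; the limit e^(xt) (e^(rt) + e^(-rt)) dominates the weight. *)
Lemma rintegrable_exp_weight_of_pseries x r :
  (forall n, rintegrable mu (fun t => t ^+ n * expR (x * t))) ->
  cvgn (pseries (fun n => exp_moment x n / n`!%:R) r) ->
  cvgn (pseries (fun n => exp_moment x n / n`!%:R) (- r)) ->
  rintegrable mu (exp_weight x r).
Proof.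
move=> xi cr cNr.
have E h n := rintegral_exp_series h n xi.
pose S n t := expR (x * t) * series (exp_coeff (r * t)) n +
              expR (x * t) * series (exp_coeff (- r * t)) n.
have cS : rintegral mu (S n) @[n --> \oo] -->
    limn (pseries (fun n => exp_moment x n / n`!%:R) r) +
    limn (pseries (fun n => exp_moment x n / n`!%:R) (- r)).
  rewrite (_ : (fun n => _) = (fun n => pseries (fun n => exp_moment x n / n`!%:R) r n +
      pseries (fun n => exp_moment x n / n`!%:R) (- r) n)); first exact: cvgD.
  apply/funext => n; rewrite rintegralD ?(proj2 (E _ _)) //; exact: (proj1 (E _ _)).
have [B [_ SB]] : bounded_fun (fun n => rintegral mu (S n)).
  by apply: cvg_seq_bounded; apply/cvg_ex; eexists; exact: cS.
pose f t := expR (x * t) * expR (r * t) + expR (x * t) * expR (- r * t).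
have mf : measurable_fun setT f.
  by apply: measurable_funD; apply: measurable_funM; exact: measurable_expRMl.
have [fi _] : rintegrable mu f /\ rintegral mu f <= B + 1.
  apply: (@rintegrable_fatou _ mu S) => //.
  - by move=> n; apply: rintegrableD; exact: (proj1 (E _ _)).
  - move=> n t; rewrite /S -mulrDr mulr_ge0 ?expR_ge0 //.
    rewrite /series /= -big_split /= sumr_ge0 // => i _.
    rewrite /exp_coeff /= -mulrDl divr_ge0 // mulNr exprNn -{1}[_ ^+ i]mul1r -mulrDl.
    rewrite -signr_odd; case: (boolP (odd i)) => oi; rewrite ?expr1 ?subrr ?mul0r //.
    by rewrite expr0 mulr_ge0 ?exprn_even_ge0.
  - by move=> t; apply: cvgD; apply: cvgM; (exact: cvg_cst || exact: exp_series_cvg).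
  - move=> n; rewrite (le_trans (ler_norm _)) // SB ?ltrDl //.
apply: rintegrable_le fi; first exact: measurable_exp_weight.
move=> t; rewrite ger0_norm /exp_weight ?mulr_ge0 ?expR_ge0 // /f -mulrDr.
rewrite ler_wpM2l ?expR_ge0 //; have [t0|t0] := ger0P t.
  by rewrite lerDl expR_ge0.
by rewrite mulrN -mulNr lerDr expR_ge0.
Qed.

End ExponentialMoments.

(** * Termwise differentiation *)

Section ComplexConvergence.
Context {R : realType}.

Lemma complex_ReB (z w : R[i]) :
  complex.Re (z - w) = complex.Re z - complex.Re w.
Proof. by case: z; case: w. Qed.

Lemma complex_ImB (z w : R[i]) :
  complex.Im (z - w) = complex.Im z - complex.Im w.
Proof. by case: z; case: w. Qed.

Lemma normc_le_ReIm (z : R[i]) :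
  `|z| <= (`|complex.Re z| + `|complex.Im z|)%:C.
Proof.
case: z => a b; rewrite normc_def lecR /= -[leRHS]ger0_norm ?addr_ge0 //.
rewrite -sqrtr_sqr ler_wsqrtr // sqrrD !real_normK ?num_real //.
by rewrite -addrA lerD2l lerDr mulrn_wge0 // mulr_ge0.
Qed.

Lemma normc_ge_Im (z : R[i]) : `|complex.Im z|%:C <= `|z|.
Proof.
case: z => a b; rewrite normc_def lecR /= -sqrtr_sqr ler_wsqrtr //.
by rewrite lerDr sqr_ge0.
Qed.

Lemma cvg_complex {T : Type} (F : set_system T) {FF : Filter F} (f : T -> R[i])
    (z : R[i]) :
  (fun t => complex.Re (f t)) @ F --> complex.Re z ->
  (fun t => complex.Im (f t)) @ F --> complex.Im z -> f @ F --> z.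
Proof.
move=> fr fi; apply/cvgrPdist_lt => -[e e'] /[!ltcE]/= /andP[/eqP -> e0].
have e2 : 0 < e / 2 by rewrite divr_gt0.
near=> t; apply: le_lt_trans (normc_le_ReIm _) _; rewrite ltcR.
rewrite (splitr e) ltrD //.
  by rewrite complex_ReB; near: t; move/cvgrPdist_lt: fr; apply.
by rewrite complex_ImB; near: t; move/cvgrPdist_lt: fi; apply.
Unshelve. all: by end_near. Qed.

Lemma cvg_complex_Re {T : Type} (F : set_system T) {FF : Filter F} (f : T -> R[i])
    (z : R[i]) : f @ F --> z ->
  (fun t => complex.Re (f t)) @ F --> complex.Re z.
Proof.
move=> fz; apply/cvgrPdist_lt => e e0.
have e0' : 0 < e%:C by rewrite ltcR.
near=> t; rewrite -ltcR -complex_ReB; apply: le_lt_trans (normc_ge_Re _) _.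
by near: t; move/cvgrPdist_lt: fz; apply.
Unshelve. all: by end_near. Qed.

Lemma cvg_complex_Im {T : Type} (F : set_system T) {FF : Filter F} (f : T -> R[i])
    (z : R[i]) : f @ F --> z ->
  (fun t => complex.Im (f t)) @ F --> complex.Im z.
Proof.
move=> fz; apply/cvgrPdist_lt => e e0.
have e0' : 0 < e%:C by rewrite ltcR.
near=> t; rewrite -ltcR -complex_ImB; apply: le_lt_trans (normc_ge_Im _) _.
by near: t; move/cvgrPdist_lt: fz; apply.
Unshelve. all: by end_near. Qed.

End ComplexConvergence.

Section TermwiseDerivative.
Context {R : realType}.
Implicit Types (c : nat -> R) (r x : R).

Lemma cvg_pseries_diffs c r x : (forall y, `|y| < r -> cvgn (pseries c y)) ->
  `|x| < r -> cvgn (pseries (pseries_diffs c) x).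
Proof.
move=> cr xr.
pose y := (`|x| + r) / 2; pose z := (y + r) / 2.
have xy : `|x| < y by rewrite /y; lra.
have yr : y < r by rewrite /y; lra.
have yz : y < z by rewrite /z; lra.
have zr : z < r by rewrite /z; lra.
have y0 : 0 < y by rewrite (le_lt_trans _ xy).
have z0 : 0 < z by rewrite (lt_trans y0).
have h0 : 0 < y - `|x| by rewrite subr_gt0.
have cy : cvgn (pseries (fun i => `|c i|) y).
  apply: (@is_cvg_pseries_inside_norm _ _ z); last by rewrite !gtr0_norm.
  by apply: cr; rewrite gtr0_norm.
(* Dividing y^(n+1) - |x|^(n+1) by y - |x| gives n+1 terms, each at least |x|^n. Passing from |x| to
   y thus pays for the factor n+1. *)
have pw n : n.+1%:R * `|x| ^+ n * (y - `|x|) <= y ^+ n.+1.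
  elim: n => [|n IH]; first by rewrite mul1r mul1r expr1 gerBl.
  have e1 : `|x| * (n.+1%:R * `|x| ^+ n * (y - `|x|)) <= `|x| * y ^+ n.+1.
    by rewrite ler_wpM2l.
  have e2 : `|x| ^+ n.+1 * (y - `|x|) <= y ^+ n.+1 * (y - `|x|).
    by rewrite ler_wpM2r ?(ltW h0) // lerXn2r ?nnegrE // ltW.
  rewrite -[in n.+2%:R]natr1 [y ^+ n.+2]exprS [`|x| ^+ n.+1]exprS in e2 *.
  lra.
apply: normed_cvg; apply: (@series_le_cvg _ _ (fun n => `|c n.+1| * y ^+ n.+1 / (y - `|x|))).
- by move=> n /=.
- by move=> n; rewrite divr_ge0 ?(ltW h0) // mulr_ge0 // exprn_ge0 // ltW.
- move=> n /=; rewrite /pseries_diffs !normrM normrX (ger0_norm (ler0n _ _)).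
  rewrite ler_pdivlMr // mulrAC (mulrC n.+1%:R) -!mulrA ler_wpM2l //.
  by have := pw n; rewrite mulrAC mulrA.
- have -> : (fun n => `|c n.+1| * y ^+ n.+1 / (y - `|x|)) =
     (y - `|x|)^-1 *: (fun n => `|c n.+1| * y ^+ n.+1).
    by apply/funext => n; rewrite [RHS]mulrC.
  apply: is_cvg_seriesZ.
  rewrite (_ : series _ = (fun n => pseries (fun i => `|c i|) y (n + 1)%N - `|c 0|)).
    apply: is_cvgB; last exact: is_cvg_cst.
    by apply/cvg_ex; eexists; rewrite cvg_shiftn; exact: cy.
  apply/funext => n; rewrite /pseries /series /= addn1 big_nat_recl //= expr0 mulr1.
  by rewrite addrAC subrr add0r.
Qed.

Definition psum c x : R := limn (pseries c x).

Lemma is_derive_psum c r x : (forall y, `|y| < r -> cvgn (pseries c y)) ->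
  `|x| < r -> is_derive x 1 (psum c) (psum (pseries_diffs c) x).
Proof.
move=> cr xr; have c'r y (yr : `|y| < r) := cvg_pseries_diffs cr yr.
have c''r y (yr : `|y| < r) := cvg_pseries_diffs c'r yr.
pose z := (`|x| + r) / 2.
have xz : `|x| < z by rewrite /z; lra.
have zr : `|z| < r by rewrite gtr0_norm ?(le_lt_trans _ xz) // /z; lra.
apply: (pseries_snd_diffs (K := z)); [exact: cr|exact: c'r|exact: c''r|].
by rewrite (lt_le_trans xz) // ler_norm.
Qed.

Lemma cvg_psum c r x : (forall y, `|y| < r -> cvgn (pseries c y)) ->
  `|x| < r -> psum c y @[y --> x] --> psum c x.
Proof.
move=> cr xr; have [d _] := is_derive_psum cr xr.
by apply: differentiable_continuous; apply/derivable1_diffP.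
Qed.

Lemma psum0 c : psum c 0 = c 0.
Proof.
apply: cvg_lim => //; rewrite -(cvg_shiftS (pseries c 0)).
rewrite (_ : (fun n => _) = cst (c 0)); first exact: cvg_cst.
apply/funext => n; rewrite /pseries /series /= big_nat_recl //= expr0 mulr1.
by rewrite big1 ?addr0 // => i _; rewrite exprS mul0r mulr0.
Qed.

Lemma iter_pseries_diffs0 n c : iter n (@pseries_diffs R) c 0 = n`!%:R * c n.
Proof.
suff H i : iter n (@pseries_diffs R) c i * i`!%:R = (i + n)`!%:R * c (i + n)%N.
  by have := H 0; rewrite fact0 mulr1.
elim: n i => [|n IH] i; first by rewrite addn0 mulrC.
rewrite iterS /pseries_diffs addnS -addSn -IH factS natrM; ring.
Qed.

Lemma iter_pseries_diffs_cvg n c r : (forall y, `|y| < r -> cvgn (pseries c y)) ->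
  forall y, `|y| < r -> cvgn (pseries (iter n (@pseries_diffs R) c) y).
Proof.
by elim: n => // n IH cr y yr; rewrite iterS; exact: cvg_pseries_diffs (IH cr) yr.
Qed.

Section ComplexCoefficients.
Variables (k : R -> R[i]) (x0 r : R) (c : nat -> R[i]).
Hypothesis r0 : 0 < r.
Hypothesis kE : forall x, `|x - x0| < r ->
  series (fun n => c n * (x - x0)%:C ^+ n) @ \oo --> k x.

Let cr n := complex.Re (c n).
Let ci n := complex.Im (c n).

Let seriesE y n : series (fun n => c n * y%:C ^+ n) n =
  pseries cr y n +i* pseries ci y n.
Proof.
rewrite /pseries /series /=; elim: n => [|n IH]; first by rewrite !big_geq.
rewrite !big_nat_recr //= IH -rmorphXn /cr /ci; case: (c n) => a b /=.
by apply/eqP; rewrite eq_complex /= !mulr0 subr0 add0r !eqxx.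
Qed.

Let pseries_cvg x : `|x| < r -> pseries cr x @ \oo --> complex.Re (k (x0 + x)) /\
  pseries ci x @ \oo --> complex.Im (k (x0 + x)).
Proof.
move=> xr; have := @kE (x0 + x); rewrite addrAC subrr add0r => /(_ xr) h.
split.
  rewrite (_ : pseries cr x = fun n => complex.Re (series (fun n => c n * x%:C ^+ n) n)).
    exact: cvg_complex_Re.
  by apply/funext => n; rewrite seriesE.
rewrite (_ : pseries ci x = fun n => complex.Im (series (fun n => c n * x%:C ^+ n) n)).
  exact: cvg_complex_Im.
by apply/funext => n; rewrite seriesE.
Qed.

Let cr_cvg y : `|y| < r -> cvgn (pseries cr y).
Proof. by case/pseries_cvg => h _; apply/cvg_ex; eexists; exact: h. Qed.

Let ci_cvg y : `|y| < r -> cvgn (pseries ci y).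
Proof. by case/pseries_cvg => _ h; apply/cvg_ex; eexists; exact: h. Qed.

(** Stated on the whole interval around x0, since the next derivative at a point depends on this one
    at nearby points. *)
Let cderive1nE n x : `|x - x0| < r -> cderive1n n k x =
  psum (iter n (@pseries_diffs R) cr) (x - x0) +i*
  psum (iter n (@pseries_diffs R) ci) (x - x0).
Proof.
elim: n x => [|n IH] x xr.
  have := pseries_cvg xr; rewrite (addrC x0) subrK => -[hr hi] /=.
  by rewrite /psum (cvg_lim _ hr) // (cvg_lim _ hi) //; case: (k x).
rewrite /cderive1n iterS -/(cderive1n n k).
have near_r : \forall h \near (0 : R)^', `|x + h - x0| < r.
  apply: nbhs_dnbhs; apply/nbhs_ballP; exists (r - `|x - x0|) => /=.
    by rewrite subr_gt0.
  move=> h; rewrite /ball /= sub0r normrN ltrBrDr addrAC addrC => hr.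
  exact: le_lt_trans (ler_normD _ _) hr.
have D (p : nat -> R) : (forall y, `|y| < r -> cvgn (pseries p y)) ->
   (psum p (x + h - x0) - psum p (x - x0)) / h @[h --> (0 : R)^'] -->
     psum (pseries_diffs p) (x - x0).
  move=> pc; have [d <-] := is_derive_psum pc xr.
  have : h^-1 *: (psum p (h *: 1 + (x - x0)) - psum p (x - x0)) @[h --> (0 : R)^']
    --> 'D_1 (psum p) (x - x0) by exact: d.
  under eq_fun => h do rewrite [_ *: _]mulrC [h *: 1]mulr1 addrCA addrA.
  by [].
have ReImdiv (z w : R[i]) (h : R) : (z - w) / h%:C =
    ((complex.Re z - complex.Re w) / h) +i* ((complex.Im z - complex.Im w) / h).
  rewrite -fmorphV; case: z w => a b [a' b'] /=; apply/eqP.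
  by rewrite eq_complex /= !mulr0 subr0 add0r !eqxx.
apply: cvg_lim; first exact: norm_hausdorff.
apply: cvg_complex => /=.
  apply: cvg_trans (D _ (iter_pseries_diffs_cvg (n := n) cr_cvg)).
  apply: near_eq_cvg; near=> h.
  have hr : `|x + h - x0| < r by near: h.
  by rewrite ReImdiv !IH.
apply: cvg_trans (D _ (iter_pseries_diffs_cvg (n := n) ci_cvg)).
apply: near_eq_cvg; near=> h.
have hr : `|x + h - x0| < r by near: h.
by rewrite ReImdiv !IH.
Unshelve. all: by end_near. Qed.

Lemma cderive1n_pseries n : cderive1n n k x0 = n`!%:R * c n.
Proof.
rewrite cderive1nE ?subrr ?normr0 // !psum0 !iter_pseries_diffs0 /cr /ci.
rewrite -(rmorph_nat (real_complex R)); case: (c n) => a b.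
by apply/eqP; rewrite eq_complex /= !mul0r subr0 addr0 !eqxx.
Qed.

(** Continuity of every derivative at the centre, by which derivatives at approaching points pass to
    the limit in [laplace_jet_closed]. *)
Lemma cderive1n_pseries_cvg n : cderive1n n k x @[x --> x0] --> n`!%:R * c n.
Proof.
rewrite -cderive1n_pseries.
have near_r : \forall x \near x0, `|x - x0| < r.
  by apply/nbhs_ballP; exists r => //= x; rewrite /ball /= distrC.
have D (p : nat -> R) : (forall y, `|y| < r -> cvgn (pseries p y)) ->
    psum p (x - x0) @[x --> x0] --> psum p 0.
  move=> pc; rewrite -[in psum p 0](subrr x0); apply: (@cvg_comp _ _ _ (fun x => x - x0) (psum p) _ (nbhs (x0 - x0))).
    by apply: cvgB; [exact: cvg_id|exact: cvg_cst].
  by apply: (cvg_psum pc); rewrite subrr normr0.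
rewrite (cderive1nE n (x := x0)) ?subrr ?normr0 //; apply: cvg_complex.
  apply: cvg_trans (D _ (iter_pseries_diffs_cvg (n := n) cr_cvg)).
  apply: near_eq_cvg; near=> x.
  by rewrite cderive1nE //; near: x.
apply: cvg_trans (D _ (iter_pseries_diffs_cvg (n := n) ci_cvg)).
apply: near_eq_cvg; near=> x.
by rewrite cderive1nE //; near: x.
Unshelve. all: by end_near. Qed.

End ComplexCoefficients.
End TermwiseDerivative.

(** * Holomorphy of the Laplace transform *)

Section Laplace.
Context {R : realType}.

(** The form |c| <= |x| covers both signs of x; used twice in a row it gives the quadratic bounds
    for cosine and sine. *)
Lemma mean_value_origin (f df : R -> R) (x : R) :
  (forall y : R, is_derive y 1 f (df y)) ->
  exists2 c, `|c| <= `|x| & f x - f 0 = df c * x.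
Proof.
move=> fd; have fc (a b : R) : {within `[a, b], continuous f}.
  apply: derivable_within_continuous => y _; exact: ex_derive.
have [x0|x0] := leP 0 x.
  have [c] := MVT_segment x0 (fun y _ => fd y) (@fc _ _).
  by rewrite in_itv /= subr0 => /andP[c0 cx] E; exists c => //; rewrite !ger0_norm.
have [c] := MVT_segment (ltW x0) (fun y _ => fd y) (@fc _ _).
rewrite in_itv /= sub0r => /andP[cx c0] E; exists c.
  by rewrite !ler0_norm ?lerN2 // ltW.
by rewrite -opprB E mulrN opprK.
Qed.

Lemma cos_sub1_le (v : R) : `|cos v - 1| <= v ^+ 2.
Proof.
have [c cv] := @mean_value_origin _ _ v (@is_derive_cos R).
rewrite cos0 => ->; rewrite mulNr normrN normrM -real_normK ?num_real // expr2.
rewrite ler_wpM2r // (le_trans _ cv) //.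
have [d dc] := @mean_value_origin _ _ c (@is_derive_sin R).
by rewrite sin0 subr0 => ->; rewrite normrM ler_piMl // ler_norml cos_geN1 cos_le1.
Qed.

Lemma sin_sub_id_le (v : R) : `|sin v - v| <= v ^+ 2.
Proof.
have [c cv] := @mean_value_origin _ _ v (@is_derive_sin R).
rewrite sin0 subr0 => ->.
rewrite -[X in _ - X]mul1r -mulrBl normrM -real_normK ?num_real // expr2.
rewrite ler_wpM2r // (le_trans _ cv) //.
have [d dc] := @mean_value_origin _ _ c (@is_derive_cos R).
rewrite cos0 => ->; rewrite normrM ler_piMl // normrN ler_norml.
by rewrite sin_geN1 sin_le1.
Qed.

Lemma expR_sub1_le (u : R) : `|expR u - 1| <= `|u| * expR `|u|.
Proof.
have h1 := expR_ge1Dx u; have h2 := expR_ge1Dx (- u).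
have e0 := expR_gt0 u; have := expRxMexpNx_1 u => e1.
have [u0|u0] := leP 0 u.
  rewrite (ger0_norm u0) ger0_norm; last lra.
  by move: h2 e1; set E := expR u in e0 *; set F := expR (- u); nra.
have e3 : 1 <= expR `|u| by rewrite -[leLHS]expR0 ler_expR.
rewrite (ltr0_norm u0) in e3 *; rewrite ler0_norm; last first.
  by rewrite subr_le0 -expR0 ler_expR ltW.
by nra.
Qed.

(** All comes from 1 + u <= e^u at u and -u and from e^u e^(-u) = 1. For u < 0 this gives e^u (1 -
    u) <= 1, hence even the bound u^2. *)
Lemma expR_sub1_sub_id_le (u : R) : `|expR u - 1 - u| <= u ^+ 2 * expR `|u|.
Proof.
have h1 := expR_ge1Dx u; have h2 := expR_ge1Dx (- u).
have e0 := expR_gt0 u; have e0' := expR_gt0 (- u); have e1 := expRxMexpNx_1 u.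
rewrite ger0_norm; last lra.
have [u0|u0] := leP 0 u.
  by rewrite (ger0_norm u0); have := expR_sub1_le u; rewrite !ger0_norm //; nra.
have e3 : 1 <= expR `|u| by rewrite -[leLHS]expR0 ler_expR.
have e4 : expR u * (1 - u) <= 1.
  by rewrite -[leRHS]e1 ler_wpM2l // ltW.
have : expR u - 1 - u <= u ^+ 2 by nra.
by move=> /le_trans; apply; rewrite ler_peMr // sqr_ge0.
Qed.

(* Componentwise form of |e^w - 1 - w| <= |w|^2 e^|w| for w = u + iv. *)
Lemma cexp_taylor1 (u v : R) :
  `|expR u * cos v - 1 - u| <= (`|u| + `|v|) ^+ 2 * expR (`|u| + `|v|) /\
  `|expR u * sin v - v| <= (`|u| + `|v|) ^+ 2 * expR (`|u| + `|v|).
Proof.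
have mono : expR `|u| <= expR (`|u| + `|v|) by rewrite ler_expR lerDl.
have Eu : expR u <= expR `|u| by rewrite ler_expR ler_norm.
have E0 := expR_ge0 u.
set W := expR (`|u| + `|v|) in mono *; set V := expR `|u| in mono Eu.
have h1 := expR_sub1_sub_id_le u; have h2 := expR_sub1_le u.
have h3 := cos_sub1_le v; have h4 := sin_sub_id_le v.
have nu := normr_ge0 u; have nv := normr_ge0 v.
rewrite -/V -[u ^+ 2]real_normK ?num_real // in h1 h2.
rewrite -[v ^+ 2]real_normK ?num_real // in h3 h4.
have W0 : 0 <= W by exact: expR_ge0.
have sq : (`|u| + `|v|) ^+ 2 * W = `|u| ^+ 2 * W + `|v| ^+ 2 * W + 2 * `|u| * `|v| * W by ring.
have c : 0 <= `|u| * `|v| * W by rewrite !mulr_ge0.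
have vb y : `|y| <= `|v| ^+ 2 -> `|expR u * y| <= `|v| ^+ 2 * W.
  move=> yb; rewrite normrM ger0_norm // mulrC ler_pM //.
  exact: le_trans Eu mono.
split.
  rewrite (_ : _ - u = (expR u - 1 - u) + expR u * (cos v - 1)); last by ring.
  rewrite (le_trans (ler_normD _ _)) // sq.
  have : `|expR u - 1 - u| <= `|u| ^+ 2 * W.
    by rewrite (le_trans h1) // ler_wpM2l // exprn_ge0.
  have := vb _ h3; lra.
rewrite (_ : _ - v = (expR u - 1) * v + expR u * (sin v - v)); last by ring.
rewrite (le_trans (ler_normD _ _)) // sq.
have : `|(expR u - 1) * v| <= `|u| * `|v| * W.
  rewrite normrM mulrAC ler_wpM2r // (le_trans h2) // ler_wpM2l //.
have := vb _ h4; have : 0 <= `|u| ^+ 2 * W by rewrite mulr_ge0 // exprn_ge0.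
lra.
Qed.

Definition cexp_re (z : R[i]) (x : R) := expR (x * complex.Re z) * cos (x * complex.Im z).
Definition cexp_im (z : R[i]) (x : R) := expR (x * complex.Re z) * sin (x * complex.Im z).

Lemma cexpE (z : R[i]) (x : R) : cexp (x%:C * z) = cexp_re z x +i* cexp_im z x.
Proof.
case: z => a b; rewrite /cexp /cexp_re /cexp_im /= !mul0r subr0 addr0.
by apply/eqP; rewrite eq_complex /= !mul0r subr0 addr0 !eqxx.
Qed.

Lemma cexp_reD (z w : R[i]) x : cexp_re (z + w) x =
  cexp_re z x * cexp_re w x - cexp_im z x * cexp_im w x.
Proof.
case: z w => a b [a' b']; rewrite /cexp_re /cexp_im /= !mulrDr expRD cosD; ring.
Qed.

Lemma cexp_imD (z w : R[i]) x : cexp_im (z + w) x =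
  cexp_re z x * cexp_im w x + cexp_im z x * cexp_re w x.
Proof.
case: z w => a b [a' b']; rewrite /cexp_re /cexp_im /= !mulrDr expRD sinD; ring.
Qed.

Lemma cexp_re_le z x : `|cexp_re z x| <= expR (x * complex.Re z).
Proof.
rewrite normrM (ger0_norm (expR_ge0 _)) ler_piMr ?expR_ge0 //.
by rewrite ler_norml cos_geN1 cos_le1.
Qed.

Lemma cexp_im_le z x : `|cexp_im z x| <= expR (x * complex.Re z).
Proof.
rewrite normrM (ger0_norm (expR_ge0 _)) ler_piMr ?expR_ge0 //.
by rewrite ler_norml sin_geN1 sin_le1.
Qed.

Lemma measurable_cexp_re z : measurable_fun setT (cexp_re z).
Proof.
apply: measurable_funM; apply: measurableT_comp; try exact: measurable_funM.
  exact: measurable_expR.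
by apply: continuous_measurable_fun; exact: continuous_cos.
Qed.

Lemma measurable_cexp_im z : measurable_fun setT (cexp_im z).
Proof.
apply: measurable_funM; apply: measurableT_comp; try exact: measurable_funM.
  exact: measurable_expR.
by apply: continuous_measurable_fun; exact: continuous_sin.
Qed.

Variable mu : {finite_measure set (measurableTypeR R) -> \bar R}.

Lemma laplaceE z : laplace mu z =
  rintegral mu (cexp_re z) +i* rintegral mu (cexp_im z).
Proof.
rewrite /laplace /cintegral -/(rintegral mu _) -/(rintegral mu _).
by congr (_ +i* _); congr rintegral; apply/funext => x; rewrite cexpE.
Qed.

Variable r : R.
Hypothesis r0 : 0 < r.
Hypothesis wi : rintegrable mu (exp_weight 0 r).

Lemma rintegrable_cexp n z : `|complex.Re z| < r ->
  rintegrable mu (fun x => x ^+ n * cexp_re z x) /\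
  rintegrable mu (fun x => x ^+ n * cexp_im z x).
Proof.
move=> zr; have s0 : 0 < r - `|complex.Re z| by rewrite subr_gt0.
have w' : rintegrable mu (exp_weight (complex.Re z) (r - `|complex.Re z|)).
  by apply: (rintegrable_exp_weight _ wi); rewrite subr0 addrC subrK.
have /rintegrable_norm h := rintegrable_exp_moment n s0 w'.
split; apply: (rintegrable_le _ _ h).
- by apply: measurable_funM; [exact: exprn_measurable|exact: measurable_cexp_re].
- move=> x; rewrite (mulrC (complex.Re z)) [leLHS]normrM [leRHS]normrM ler_wpM2l //.
  rewrite [leRHS]ger0_norm ?expR_ge0 //.
  exact: cexp_re_le.
- by apply: measurable_funM; [exact: exprn_measurable|exact: measurable_cexp_im].
- move=> x; rewrite (mulrC (complex.Re z)) [leLHS]normrM [leRHS]normrM ler_wpM2l //.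
  rewrite [leRHS]ger0_norm ?expR_ge0 //.
  exact: cexp_im_le.
Qed.

(** Dominates the second-order remainder: r/2 leaves r/4 for Re z and r/4 for the increment, while
    the other half of r absorbs x^2. *)
Let w x := x ^+ 2 * expR (r / 2 * `|x|).

Let w_int : rintegrable mu w.
Proof.
have r2 : 0 < r / 2 by rewrite divr_gt0.
apply: (rintegrable_le _ _ (rintegrableZ (2`!%:R / (r / 2) ^+ 2) wi)).
  apply: measurable_funM; first exact: exprn_measurable.
  apply: measurableT_comp; first exact: measurable_expR.
  by apply: measurable_funM => //; exact: measurableT_comp.
move=> x; rewrite /w normrM (ger0_norm (expR_ge0 _)) normrX /exp_weight mul0r expR0 mul1r.
have -> : expR (r * `|x|) = expR (r / 2 * `|x|) * expR (r / 2 * `|x|).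
  by rewrite -expRD -mulrDl -splitr.
rewrite mulrA ler_wpM2r ?expR_ge0 //.
exact: exprn_le_expR.
Qed.

(** Real part of e^((z+h)x) - e^(zx) - h x e^(zx). The exponent in [x ^+ 1] lets [rintegrable_cexp]
    apply as it stands. *)
Let remainder_re (z h : R[i]) x := cexp_re (z + h) x - cexp_re z x -
  (complex.Re h * (x ^+ 1 * cexp_re z x) - complex.Im h * (x ^+ 1 * cexp_im z x)).
Let remainder_im (z h : R[i]) x := cexp_im (z + h) x - cexp_im z x -
  (complex.Re h * (x ^+ 1 * cexp_im z x) + complex.Im h * (x ^+ 1 * cexp_re z x)).

(** The remainder is e^(zx) (e^(hx) - 1 - hx). Each of its components is a combination of two
    products of components, whence the factor 2. *)
Let remainder_le z h x : `|complex.Re z| <= r / 4 ->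
  `|complex.Re h| + `|complex.Im h| <= r / 4 ->
  `|remainder_re z h x| <= 2 * (`|complex.Re h| + `|complex.Im h|) ^+ 2 * w x /\
  `|remainder_im z h x| <= 2 * (`|complex.Re h| + `|complex.Im h|) ^+ 2 * w x.
Proof.
set eta := _ + _ => zr hr.
have := cexp_taylor1 (x * complex.Re h) (x * complex.Im h).
rewrite !normrM -mulrDr -/eta; set Er := _ - _; set Ei := _ - _ => -[hEr hEi].
have b y E : `|y| <= expR (x * complex.Re z) ->
    `|E| <= (`|x| * eta) ^+ 2 * expR (`|x| * eta) -> `|y * E| <= eta ^+ 2 * w x.
  move=> yb Eb; rewrite normrM (le_trans (ler_pM _ _ yb Eb)) //.
  rewrite exprMn real_normK ?num_real // /w.
  rewrite [leLHS](_ : _ = eta ^+ 2 * (x ^+ 2 * (expR (x * complex.Re z) * expR (`|x| * eta)))); last by ring.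
  rewrite !ler_wpM2l ?sqr_ge0 // -expRD ler_expR.
  have : x * complex.Re z <= r / 4 * `|x|.
    by rewrite (le_trans (ler_norm _)) // normrM mulrC ler_wpM2r.
  have : `|x| * eta <= r / 4 * `|x| by rewrite mulrC ler_wpM2r.
  by rewrite (_ : r / 2 = r / 4 + r / 4); lra.
have b1 := b _ _ (cexp_re_le z x) hEr; have b2 := b _ _ (cexp_re_le z x) hEi.
have b3 := b _ _ (cexp_im_le z x) hEr; have b4 := b _ _ (cexp_im_le z x) hEi.
split.
  rewrite (_ : remainder_re z h x = cexp_re z x * Er - cexp_im z x * Ei); last first.
    by rewrite /remainder_re cexp_reD /Er /Ei /cexp_re /cexp_im; ring.
  by rewrite (le_trans (ler_normB _ _)) //; lra.
rewrite (_ : remainder_im z h x = cexp_re z x * Ei + cexp_im z x * Er); last first.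
  by rewrite /remainder_im cexp_imD /Er /Ei /cexp_re /cexp_im; ring.
by rewrite (le_trans (ler_normD _ _)) //; lra.
Qed.

Let dlaplace z : R[i] := rintegral mu (fun x => x ^+ 1 * cexp_re z x) +i*
                         rintegral mu (fun x => x ^+ 1 * cexp_im z x).

Let laplace_remainder z h : `|complex.Re z| <= r / 4 ->
  `|complex.Re h| + `|complex.Im h| <= r / 4 ->
  `|laplace mu (z + h) - laplace mu z - h * dlaplace z| <=
  (4 * (`|complex.Re h| + `|complex.Im h|) ^+ 2 * rintegral mu w)%:C.
Proof.
move=> zr hr.
have r4 : r / 4 < r by have := r0; lra.
have i0 y : `|complex.Re y| < r -> rintegrable mu (cexp_re y) /\ rintegrable mu (cexp_im y).
  move=> /(rintegrable_cexp 0)[a b]; split.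
    by move: a; under eq_fun do rewrite mul1r.
  by move: b; under eq_fun do rewrite mul1r.
have zhr : `|complex.Re (z + h)| < r.
  rewrite (_ : complex.Re (z + h) = complex.Re z + complex.Re h); last by case: z h {zr hr} => ? ? [].
  have := normr_ge0 (complex.Im h).
  by have := ler_normD (complex.Re z) (complex.Re h); lra.
have [a0 a1] := i0 _ zhr; have [b0 b1] := i0 _ (le_lt_trans zr r4).
have [c0 c1] := rintegrable_cexp 1 (le_lt_trans zr r4).
have rI : rintegrable mu (remainder_re z h).
  by apply: rintegrableB; [exact: rintegrableB|apply: rintegrableB; exact: rintegrableZ].
have iI : rintegrable mu (remainder_im z h).
  by apply: rintegrableB; [exact: rintegrableB|apply: rintegrableD; exact: rintegrableZ].
have E : laplace mu (z + h) - laplace mu z - h * dlaplace z =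
    rintegral mu (remainder_re z h) +i* rintegral mu (remainder_im z h).
  rewrite /remainder_re /remainder_im.
  rewrite !rintegralB ?rintegralD ?rintegralZ //;
    try (by [exact: rintegrableB|exact: rintegrableZ|
      apply: rintegrableB; exact: rintegrableZ|
      apply: rintegrableD; exact: rintegrableZ]).
  rewrite !laplaceE /dlaplace; case: (h) => p q; apply/eqP; rewrite eq_complex /=.
  by apply/andP; split; apply/eqP; ring.
rewrite E (le_trans (normc_le_ReIm _)) // lecR /=.
have wI : rintegrable mu (fun x => 2 * (`|complex.Re h| + `|complex.Im h|) ^+ 2 * w x).
  exact: rintegrableZ.
have n1 := rintegral_norm_le rI wI (fun x => proj1 (remainder_le x zr hr)).
have n2 := rintegral_norm_le iI wI (fun x => proj2 (remainder_le x zr hr)).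
by rewrite rintegralZ // in n1 n2; lra.
Qed.

Let laplace_derivable z : `|complex.Re z| <= r / 4 -> derivable (laplace mu) z 1.
Proof.
move=> zr; apply/cvg_ex; exists (dlaplace z).
apply/cvgrPdist_le => e e0.
(* 16 is 4 times 2^2: the remainder bound has the factor 4, and |Re h| + |Im h| <= 2|h| gets
   squared. The same inequality explains r/8 below. *)
pose C := (16 * rintegral mu w)%:C.
have C0 : 0 <= C.
  rewrite lecR mulr_ge0 // rintegral_ge0 // => x.
  by rewrite mulr_ge0 ?sqr_ge0 ?expR_ge0.
have C1 : 0 < C + 1 by rewrite ltr_wpDl.
have r8 : 0 < (r / 8)%:C by rewrite ltcR divr_gt0.
near=> h.
have hn0 : h != 0 by near: h; exact: nbhs_dnbhs_neq.
have hr : `|h| < (r / 8)%:C.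
  by near: h; apply: nbhs_dnbhs; apply/nbhs_ballP; exists (r / 8)%:C => //= y; rewrite /ball /= sub0r normrN.
have he : `|h| < e / (C + 1).
  near: h; apply: nbhs_dnbhs; apply/nbhs_ballP; exists (e / (C + 1)) => /=; first by rewrite divr_gt0.
  by move=> y; rewrite /ball /= sub0r normrN.
have hRI : (`|complex.Re h| + `|complex.Im h|)%:C <= 2 * `|h|.
  by rewrite rmorphD /= mulr_natl mulr2n lerD ?normc_ge_Re ?normc_ge_Im.
have hr4 : `|complex.Re h| + `|complex.Im h| <= r / 4.
  rewrite -lecR (le_trans hRI) // (_ : (r / 4)%:C = 2 * (r / 8)%:C).
    by rewrite ler_wpM2l // ltW.
  by rewrite -[2]/(2%:R) -(rmorph_nat (real_complex R)) -rmorphM; congr (_ %:C); lra.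
have := laplace_remainder zr hr4; rewrite [h *: 1]mulr1.
set D := dlaplace z => b.
have -> : D - h^-1 *: (laplace mu (h + z) - laplace mu z) =
    - (h^-1 * (laplace mu (z + h) - laplace mu z - h * D)).
  by rewrite [_ *: _]/(_ * _) (addrC h) mulrBr mulKf // opprB.
rewrite normrN normrM normfV ler_pdivrMl ?normr_gt0 // (le_trans b) //.
have W0 : 0 <= (4 * rintegral mu w)%:C.
  by rewrite lecR mulr_ge0 // rintegral_ge0 // => x; rewrite mulr_ge0 ?sqr_ge0 ?expR_ge0.
apply: (@le_trans _ _ ((4 * rintegral mu w)%:C * (2 * `|h|) ^+ 2)).
  rewrite mulrAC rmorphM /= ler_wpM2l // rmorphXn lerXn2r // nnegrE.
    by rewrite lecR addr_ge0.
  by rewrite mulr_ge0.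
rewrite exprMn mulrA expr2 mulrA mulrC ler_wpM2l //.
have -> : (4 * rintegral mu w)%:C * (2 * 2) = C.
  have two : (2 : R[i]) = 2%:C by rewrite rmorph_nat.
  by rewrite two -!rmorphM /C; congr (_ %:C); ring.
apply: (@le_trans _ _ ((C + 1) * `|h|)); first by rewrite ler_wpM2r // lerDl.
by rewrite mulrC -ler_pdivlMr // ltW.
Unshelve. all: by end_near. Qed.

Lemma has_analytic_laplace_of_exp_weight : has_analytic_laplace mu.
Proof.
have r4 : 0 < (r / 4)%:C by rewrite ltcR; have := r0; lra.
have near_z : \forall z \near (0 : R[i]), `|complex.Re z| <= r / 4.
  apply/nbhs_ballP; exists (r / 4)%:C => //= z; rewrite /ball /= sub0r normrN => zr.
  by rewrite -lecR (le_trans (normc_ge_Re _)) // ltW.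
split; last by apply: filterS near_z => z; exact: laplace_derivable.
apply: filterS near_z => z zr.
have [|a b] := @rintegrable_cexp 0 z; first by have := r0; lra.
split.
  rewrite (_ : (fun x => _) = EFin \o (fun x => x ^+ 0 * cexp_re z x)) //.
  by apply/funext => x; rewrite cexpE /= expr0 mul1r.
rewrite (_ : (fun x => _) = EFin \o (fun x => x ^+ 0 * cexp_im z x)) //.
by apply/funext => x; rewrite cexpE /= expr0 mul1r.
Qed.

End Laplace.

(** * Continuation along the interval of analyticity *)

Section Continuation.
Context {R : realType}.

Lemma cvg_real_complex {T : Type} (F : set_system T) {FF : Filter F} (f : T -> R)
    (l : R) : f @ F --> l -> (fun t => (f t)%:C) @ F --> l%:C.
Proof. by move=> fl; apply: cvg_complex => //=; exact: cvg_cst. Qed.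

Lemma series_real_complex (c : nat -> R) (y : R) :
  series (fun n => (c n)%:C * y%:C ^+ n) = (fun n => (pseries c y n)%:C).
Proof.
apply/funext => n; rewrite /pseries /series /= rmorph_sum /=.
by apply: eq_bigr => i _; rewrite rmorphM rmorphXn.
Qed.

(** Closedness is asked only for sequences between 0 and their limit, which is where
    [laplace_jet_closed] finds a dominating function. *)
Lemma interval_continuation (P : R -> Prop) : P 0 ->
  (forall s : R, 0 <= s <= 1 -> P s ->
     exists2 e : R, 0 < e & forall s', `|s' - s| < e -> P s') ->
  (forall (s : R) (u : nat -> R), 0 <= s <= 1 -> u @ \oo --> s ->
     (forall j, 0 <= u j <= s /\ P (u j)) -> P s) ->
  P 1.
Proof.
move=> P0 Popen Pclosed.
pose S := [set s : R | 0 <= s <= 1 /\ forall s' : R, 0 <= s' <= s -> P s'].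
have S0 : S 0.
  by split=> [|s' /andP[a b]]; [rewrite lexx ler01|rewrite (_ : s' = 0) //; apply/le_anti/andP].
have Sub : ubound S 1 by move=> s [/andP[]].
have hS : has_sup S by split; [exists 0|exists 1].
pose sg := sup S.
have sg01 : 0 <= sg <= 1.
  by rewrite ub_le_sup ?ge_sup //; [exists 0|exact: proj2 hS].
have adh j : exists2 s, S s & sg - j.+1%:R^-1 < s.
  by apply: sup_adherent => //; rewrite invr_gt0.
have /choice[u uP] : forall j, exists s, S s /\ sg - j.+1%:R^-1 < s.
  by move=> j; have [s Ss sj] := adh j; exists s.
have usg j : 0 <= u j <= sg.
  have [Su _] := uP j; have [/andP[-> _] _] := Su.
  by rewrite ub_le_sup //; exact: proj2 hS.
have Psg : P sg.
  apply: (Pclosed _ u) => //.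
    apply: (@cvg_harmonic_bound _ _ 1) => j; have [_ uj] := uP j; have /andP[_ us] := usg j.
    by rewrite mulr1 ger0_norm ?subr_ge0 // lerBlDl -lerBlDr ltW.
  by move=> j; split => //; have [[/andP[a _] Pu] _] := uP j; apply: Pu; rewrite a lexx.
have [e e0 Pe] := Popen _ sg01 Psg.
have PS s : 0 <= s -> s < sg + e -> P s.
  move=> s0 se; have [ss|ss] := ltP (sg - e) s; first by apply: Pe; rewrite ltr_norml; lra.
  have [s' [_ Ss'] ssg] := sup_adherent e0 hS.
  by apply: Ss'; rewrite s0 (le_trans ss) // ltW.
apply: (PS 1) => //; rewrite ltNge; apply/negP => sge.
have : S (sg + e / 2).
  split; first by have /andP[] := sg01; lra.
  by move=> s' /andP[s0 s1]; apply: PS => //; lra.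
by move=> /(ub_le_sup (proj2 hS)); rewrite -/sg; lra.
Qed.

Variables (mu : {finite_measure set (measurableTypeR R) -> \bar R}) (k : R -> R[i]).

Definition analytic_at (x : R) := exists c : nat -> R[i],
  \forall y \near x, series (fun n => c n * (y - x)%:C ^+ n) @ \oo --> k y.

Definition laplace_jet (x : R) :=
  (forall n, rintegrable mu (fun t => t ^+ n * expR (x * t))) /\
  forall n, cderive1n n k x = (exp_moment mu x n)%:C.

Lemma laplace_jet_of_eq (x r : R) : 0 < r -> rintegrable mu (exp_weight x r) ->
  (forall y, `|y - x| < r -> k y = (exp_moment mu y 0)%:C) -> laplace_jet x.
Proof.
move=> r0 wi kE; split=> [n|n]; first exact: rintegrable_exp_moment r0 wi.
rewrite (@cderive1n_pseries _ k x r (fun n => (exp_moment mu x n / n`!%:R)%:C)) //.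
  by rewrite -(rmorph_nat (real_complex R)) -rmorphM mulrC divfK.
move=> y yr; rewrite series_real_complex kE //; apply: cvg_real_complex.
have := exp_moment_pseries r0 (ltW yr) wi.
by rewrite (addrC x) subrK.
Qed.

(** The Taylor coefficients of [k] at x are moments over n!, so convergence of the series makes a
    weight integrable and identifies [k] with the transform near x. The radius r/2 keeps both end
    points inside the open interval of convergence. *)
Lemma laplace_jet_open x : analytic_at x -> laplace_jet x ->
  exists2 r : R, 0 < r & forall y, `|y - x| < r -> laplace_jet y.
Proof.
move=> [c /nbhs_ballP[r /= r0 kE]] [xi xm].
have {}kE y : `|y - x| < r -> series (fun n => c n * (y - x)%:C ^+ n) @ \oo --> k y.
  by move=> yr; apply: kE; rewrite /ball /= distrC.
have cE : c = fun n => (exp_moment mu x n / n`!%:R)%:C.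
  apply/funext => n; have := xm n; rewrite (cderive1n_pseries r0 kE).
  rewrite -(rmorph_nat (real_complex R)) => e.
  have f0 : (n`!%:R)%:C != 0 :> R[i] by rewrite fmorph_eq0 pnatr_eq0 -lt0n fact_gt0.
  by apply: (mulfI f0); rewrite e -rmorphM mulrC divfK.
have cvx y : `|y| < r ->
    pseries (fun n => exp_moment mu x n / n`!%:R) y @ \oo --> complex.Re (k (x + y)).
  move=> yr; have := @kE (x + y); rewrite addrAC subrr add0r => /(_ yr).
  by rewrite cE series_real_complex => /cvg_complex_Re.
have r2 : 0 < r / 2 by rewrite divr_gt0.
have r2r : r / 2 < r by rewrite ltr_pdivrMr // ltr_pMr // ltr1n.
have wi : rintegrable mu (exp_weight x (r / 2)).
  apply: rintegrable_exp_weight_of_pseries => //; apply/cvg_ex; eexists; apply: cvx;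
  by rewrite ?normrN gtr0_norm.
have kE' y : `|y - x| < r / 2 -> k y = (exp_moment mu y 0)%:C.
  move=> yr; have h := kE y (lt_trans yr r2r).
  have := @cvg_real_complex _ \oo _ _ _ (exp_moment_pseries r2 (ltW yr) wi).
  rewrite (addrC x) subrK => h'.
  rewrite cE series_real_complex in h.
  exact: (cvg_unique _ h (h' _)).
exists (r / 2) => // y yr.
have s0 : 0 < r / 2 - `|y - x| by rewrite subr_gt0.
apply: (laplace_jet_of_eq s0).
  by apply: rintegrable_exp_weight wi; rewrite addrC subrK.
move=> z zr; apply: kE'.
by have := ler_distD y z x; lra.
Qed.

(** The moments at [u j] converge to derivatives of [k], hence are bounded. For even order Fatou
    then gives integrability at x, which in turn supplies a dominating function for every order. *)
Lemma laplace_jet_closed x (u : nat -> R) : analytic_at x -> laplace_jet 0 ->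
  u @ \oo --> x -> (forall j, (exists2 s : R, 0 <= s <= 1 & u j = s * x) /\ laplace_jet (u j)) ->
  laplace_jet x.
Proof.
move=> [c /nbhs_ballP[r /= r0 kE]] [zi zm] ux uP.
have {}kE y : `|y - x| < r -> series (fun n => c n * (y - x)%:C ^+ n) @ \oo --> k y.
  by move=> yr; apply: kE; rewrite /ball /= distrC.
have cvd n : (exp_moment mu (u j) n)%:C @[j --> \oo] --> cderive1n n k x.
  rewrite (cderive1n_pseries r0 kE).
  have := cvg_comp _ _ ux (@cderive1n_pseries_cvg _ _ _ _ _ r0 kE n).
  rewrite (_ : _ \o u = fun j => (exp_moment mu (u j) n)%:C) //.
  by apply/funext => j /=; have [_ [_ ->]] := uP j.
have cvm n := cvg_complex_Re (cvd n); rewrite /= in cvm.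
have ut n (t : R) : t ^+ n * expR (u j * t) @[j --> \oo] --> t ^+ n * expR (x * t).
  apply: cvgM; first exact: cvg_cst.
  apply: continuous_cvg; first exact: continuous_expR.
  by apply: cvgM => //; exact: cvg_cst.
have int_even n : ~~ odd n -> rintegrable mu (fun t => t ^+ n * expR (x * t)).
  move=> ne.
  have [B [_ Bu]] : bounded_fun (fun j => exp_moment mu (u j) n).
    by apply: cvg_seq_bounded; apply/cvg_ex; eexists; exact: cvm.
  apply: (proj1 (@rintegrable_fatou _ mu (fun j t => t ^+ n * expR (u j * t)) _ (B + 1) _ _ _ _ _)).
  - by move=> j; have [_ [+ _]] := uP j; apply.
  - by move=> j t; rewrite mulr_ge0 ?expR_ge0 // exprn_even_ge0.
  - exact: measurable_exprM_expR.
  - exact: ut.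
  - by move=> j; rewrite (le_trans (ler_norm _)) // Bu ?ltrDl.
have int_all n : rintegrable mu (fun t => t ^+ n * expR (x * t)).
  have e0 := int_even 0%N isT.
  have /(rintegrableD e0) : rintegrable mu (fun t => t ^+ (2 * n) * expR (x * t)).
    by apply: int_even; rewrite oddM.
  apply: rintegrable_le; first exact: measurable_exprM_expR.
  move=> t; rewrite normrM (ger0_norm (expR_ge0 _)) -mulrDl ler_wpM2r ?expR_ge0 //.
  rewrite expr0 mulnC exprM -[_ ^+ 2]real_normK ?num_real //.
  by have : 0 <= `|t ^+ n| by []; nra.
split=> // n.
(* With u j = s x and 0 <= s <= 1, the exponential is at most e^(xt) where xt >= 0 and at most 1
   elsewhere; the jet at 0 makes the second summand integrable. *)
have gi : rintegrable mu (fun t => `|t ^+ n * expR (x * t)| + `|t ^+ n * expR (0 * t)|).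
  by apply: rintegrableD; apply: rintegrable_norm; [exact: int_all|exact: zi].
have cvi : exp_moment mu (u j) n @[j --> \oo] --> exp_moment mu x n.
  apply: (proj2 (@rintegral_dominated _ mu (fun j t => t ^+ n * expR (u j * t))
    (fun t => t ^+ n * expR (x * t)) _ (fun j => measurable_exprM_expR n (u j))
    (measurable_exprM_expR n x) (ut n) gi _)) => j t.
  rewrite !normrM -mulrDr ler_wpM2l // !(ger0_norm (expR_ge0 _)) mul0r expR0.
  have [[s /andP[s0 s1] ->] _] := uP j; rewrite -mulrA.
  have [xt0|xt0] := leP 0 (x * t).
    apply: (@le_trans _ _ (expR (x * t))); last by rewrite lerDl.
    by rewrite ler_expR ler_piMl.
  apply: (@le_trans _ _ 1); last by rewrite lerDr expR_ge0.
  by rewrite -[leRHS]expR0 ler_expR mulr_ge0_le0 // ltW.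
exact: (cvg_unique _ (cvd n) (@cvg_real_complex _ \oo _ _ _ cvi)).
Qed.

Lemma laplace_jet_segment (x : R) : laplace_jet 0 ->
  (forall s : R, 0 <= s <= 1 -> analytic_at (s * x)) -> laplace_jet x.
Proof.
move=> j0 an; rewrite -(mul1r x).
apply: (@interval_continuation (fun s => laplace_jet (s * x))).
- by rewrite mul0r.
- move=> s s01 /(laplace_jet_open (an _ s01))[e e0 H].
  have x1 : 0 < `|x| + 1 by rewrite ltr_wpDl.
  exists (e / (`|x| + 1)); first by rewrite divr_gt0.
  move=> s'; rewrite (ltr_pdivlMr _ _ x1) => s'e; apply: H.
  by rewrite -mulrBl normrM (le_lt_trans _ s'e) // ler_wpM2l // lerDl.
- move=> s u s01 us uP; apply: (laplace_jet_closed (an _ s01) j0 (u := fun j => u j * x)).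
    by apply: cvgM => //; exact: cvg_cst.
  move=> j; have [/andP[u0 ujs] Pu] := uP j; split => //.
  (* The witness is the ratio of [u j] to s; for s = 0 all [u j] vanish and 0 serves. *)
  have [s0|s0] := eqVneq s 0.
    exists 0; first by rewrite lexx ler01.
    by rewrite (_ : u j = 0) ?mul0r //; apply/le_anti; rewrite u0 andbT -s0.
  have sgt : 0 < s by rewrite lt_neqAle eq_sym s0 (le_trans u0).
  exists (u j / s); first by rewrite divr_ge0 ?(ltW sgt) //= ler_pdivrMr // mul1r.
  by rewrite mulrA divfK.
Qed.

End Continuation.

(** * Exponential convexity *)

Section ExponentialConvexity.
Context {R : realType}.

Lemma sym_itvE (b : \bar R) (x : R) : sym_itv b x <-> (`|x|%:E < b)%E.
Proof.
rewrite /sym_itv /=; case: b => [b| |] /=.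
- rewrite !lte_fin ltr_norml; split; [by move=> [-> ->]|by move=> /andP].
- by rewrite !ltry ltNyr.
- by split; [move=> [_]|rewrite ltNge leNye].
Qed.

Lemma exponentially_convexP (a : \bar R) (k : R -> R[i]) :
  exponentially_convex a k <->
  forall N (f : nat -> R[i]) (x : nat -> R), (forall i, sym_itv a (x i)) ->
    0 <= \sum_(i < N) \sum_(j < N) k (x i + x j) * f i * (f j)^*.
Proof.
have trunc N (f : nat -> R[i]) x : (forall n, (N <= n)%N -> f n = 0) ->
    \sum_(i \in [set: nat]) \sum_(j \in [set: nat]) k (x i + x j) * f i * (f j)^* =
    \sum_(i < N) \sum_(j < N) k (x i + x j) * f i * (f j)^*.
  move=> fN.
  have fs (F : nat -> R[i]) : (forall n, (N <= n)%N -> F n = 0) ->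
      \sum_(i \in [set: nat]) F i = \sum_(i < N) F i.
    move=> FN; rewrite fsbig_ord; apply/esym/fsbig_widen => // n [_ /= nN].
    by apply: FN; rewrite leqNgt; apply/negP.
  rewrite fs => [|n nN].
    by apply: eq_bigr => i _; apply: fs => n nN; rewrite (fN n) // conjC0 mulr0.
  by rewrite fsbig1 // => j _; rewrite fN // mulr0 mul0r.
split=> [H N f x xa|H f x ff xa].
  pose g n := if (n < N)%N then f n else 0.
  have gN n : (N <= n)%N -> g n = 0 by rewrite /g ltnNge => ->.
  have fg : finitely_supported g.
    apply: (sub_finite_set _ (finite_II N)) => n /= gn.
    by rewrite ltnNge; apply: contraNN gn => /gN ->.
  have := H g x fg xa; rewrite (trunc N) //.
  congr (0 <= _); apply: eq_bigr => i _; apply: eq_bigr => j _.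
  by rewrite /g !ltn_ord.
have [N fN] : exists N, forall n, (N <= n)%N -> f n = 0.
  have /finite_seqP[s sE] := ff.
  exists (\max_(i <- s) i).+1 => n sn; apply: contrapT => /eqP fn.
  have : (n <= \max_(i <- s) i)%N.
    apply: leq_bigmax_seq => //.
    by have : [set` s] n by rewrite -sE.
  by rewrite leqNgt sn.
by rewrite (trunc N) //; exact: H.
Qed.

Lemma sym_itv_half (a : \bar R) (x : R) :
  sym_itv (2%:E * a)%E x -> sym_itv a (x / 2).
Proof.
rewrite !sym_itvE; case: a => [a| |].
- by rewrite -EFinM !lte_fin normrM (@ger0_norm _ 2^-1) ?invr_ge0 // => h; lra.
- by rewrite !ltry.
- by rewrite mulrNy gtr0_sg // mul1e.
Qed.

Lemma sym_itv_double (a : \bar R) (x y : R) :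
  sym_itv a x -> sym_itv a y -> sym_itv (2%:E * a)%E (x + y).
Proof.
rewrite !sym_itvE; case: a => [a| |] //.
- by rewrite -EFinM !lte_fin => ? ?; rewrite (le_lt_trans (ler_normD _ _)) //; lra.
- by move=> _ _; rewrite mulry gtr0_sg // mul1e ltry.
Qed.

(** The form at the single point x/2. Nonnegativity in [R[i]] includes being real, so [k] is real on
    the whole interval. *)
Lemma exponentially_convex_ge0 (a : \bar R) (k : R -> R[i]) x :
  exponentially_convex a k -> sym_itv (2%:E * a)%E x -> 0 <= k x.
Proof.
move=> /exponentially_convexP H xa.
have := H 1%N (fun=> 1) (fun=> x / 2) (fun=> sym_itv_half xa).
by rewrite !big_ord1 -splitr conjC1 !mulr1.
Qed.

Lemma exponentially_convex_form (a : \bar R) (k : R -> R[i]) N (c x : nat -> R) :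
  exponentially_convex a k -> (forall i, sym_itv a (x i)) ->
  0 <= \sum_(i < N) \sum_(j < N) complex.Re (k (x i + x j)) * (c i * c j).
Proof.
move=> H xa; have k0 i j : (complex.Re (k (x i + x j)))%:C = k (x i + x j).
  have := exponentially_convex_ge0 H (sym_itv_double (xa i) (xa j)).
  by case: (k _) => p q; rewrite lecE /= => /andP[/eqP -> _].
move: H => /exponentially_convexP /(_ N (fun i => (c i)%:C) x xa).
rewrite -lecR rmorph_sum /=; congr (0 <= _); apply: eq_bigr => i _.
rewrite rmorph_sum /=; apply: eq_bigr => j _.
have -> : Num.conj (c j)%:C = (c j)%:C by exact: conjc_real.
by rewrite !rmorphM /= k0 mulrA.
Qed.

Lemma exponentially_convex_laplace (mu : {finite_measure set (measurableTypeR R) -> \bar R})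
    (a : \bar R) (k : R -> R[i]) :
  (forall x, sym_itv (2%:E * a)%E x -> rintegrable mu (fun t => expR (x * t)) /\
     k x = (rintegral mu (fun t => expR (x * t)))%:C) ->
  exponentially_convex a k.
Proof.
move=> H; apply/exponentially_convexP => N f x xa.
pose M i j := rintegral mu (fun t => expR ((x i + x j) * t)).
have HM i j := H _ (sym_itv_double (xa i) (xa j)).
have Msym i j : M i j = M j i by rewrite /M addrC.
have pos (c : nat -> R) : 0 <= \sum_(i < N) \sum_(j < N) M i j * (c i * c j).
  have -> : \sum_(i < N) \sum_(j < N) M i j * (c i * c j) =
      rintegral mu (fun t => (\sum_(i < N) c i * expR (x i * t)) ^+ 2).
    transitivity (rintegral mu (fun t => \sum_(i < N) \sum_(j < N)
        c i * c j * expR ((x i + x j) * t))).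
      have int i j : rintegrable mu (fun t => c i * c j * expR ((x i + x j) * t)).
        by apply: rintegrableZ; have [] := HM i j.
      rewrite rintegral_sum => [|i _]; last by apply: rintegrable_sum => j _; exact: int.
      apply: eq_bigr => i _; rewrite rintegral_sum => [|j _]; last exact: int.
      apply: eq_bigr => j _; rewrite (rintegralZ _ (proj1 (HM i j))).
      exact: mulrC.
    congr rintegral; apply/funext => t; rewrite expr2 big_distrl /=.
    apply: eq_bigr => i _; rewrite big_distrr /=; apply: eq_bigr => j _.
    by rewrite mulrDl expRD; ring.
  by apply: rintegral_ge0 => t; rewrite sqr_ge0.
pose p i := complex.Re (f i); pose q i := complex.Im (f i).
(* With f = p + iq the form splits into two real forms and an imaginary part, which cancels by the
   symmetry of [M]. *)
have -> : \sum_(i < N) \sum_(j < N) k (x i + x j) * f i * (f j)^* =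
    (\sum_(i < N) \sum_(j < N) M i j * (p i * p j) +
     \sum_(i < N) \sum_(j < N) M i j * (q i * q j))%:C +
    (\sum_(i < N) \sum_(j < N) M i j * (q i * p j) -
     \sum_(i < N) \sum_(j < N) M i j * (p i * q j))%:C * (0 +i* 1).
  rewrite -sumrB -big_split !rmorph_sum big_distrl -big_split /=.
  apply: eq_bigr => i _; rewrite -sumrB -big_split !rmorph_sum big_distrl -big_split /=.
  apply: eq_bigr => j _; have [_ ->] := HM i j; rewrite -/(M i j) /p /q.
  case: (f i) (f j) => a1 b1 [a2 b2]; rewrite -[Num.conj _]/(conjc _); apply/eqP.
  by rewrite eq_complex /=; apply/andP; split; apply/eqP; ring.
rewrite [X in _ - X]exchange_big /=.
have -> : \sum_(j < N) \sum_(i < N) M i j * (p i * q j) =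
    \sum_(i < N) \sum_(j < N) M i j * (q i * p j).
  by apply: eq_bigr => i _; apply: eq_bigr => j _; rewrite Msym (mulrC (p _)).
by rewrite subrr mul0r addr0 lecR addr_ge0.
Qed.

End ExponentialConvexity.

(** * Analytic moment functionals and their exponential series *)

Section AnalyticMoments.
Context {R : realType}.

(** At two opposite real points r and -r of the neighbourhood, e^(rt) and e^(-rt) are integrable,
    and their sum dominates e^(r|t|). *)
Lemma exp_weight_of_analytic_laplace
    (mu : {finite_measure set (measurableTypeR R) -> \bar R}) :
  has_analytic_laplace mu -> exists2 r : R, 0 < r & rintegrable mu (exp_weight 0 r).
Proof.
move=> [/nbhs_ballP[[e e'] /= +] H _]; rewrite ltcE /= => /andP[/eqP e'0 e0].
rewrite {}e'0 in H.
have int s : `|s| < e -> rintegrable mu (fun t => expR (s * t)).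
  move=> se; have [|+ _] := H s%:C.
    by rewrite /ball /= sub0r normrN normc_def /= expr0n addr0 sqrtr_sqr ltcR.
  rewrite /rintegrable; congr (integrable _ _ _); apply/funext => t /=.
  by rewrite !(mul0r, mulr0, subr0, addr0) cos0 mulr1 mulrC.
have e2 : 0 < e / 2 by rewrite divr_gt0.
have e2e : e / 2 < e by rewrite ltr_pdivrMr // ltr_pMr // ltr1n.
exists (e / 2) => //.
have i1 : rintegrable mu (fun t => expR (e / 2 * t)) by apply: int; rewrite gtr0_norm.
have i2 : rintegrable mu (fun t => expR (- (e / 2) * t)).
  by apply: int; rewrite normrN gtr0_norm.
apply: rintegrable_le (rintegrableD i1 i2); first exact: measurable_exp_weight.
move=> t; rewrite ger0_norm /exp_weight ?mulr_ge0 ?expR_ge0 // mul0r expR0 mul1r.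
have [t0|t0] := ger0P t; first by rewrite lerDl expR_ge0.
by rewrite mulrN -mulNr lerDr expR_ge0.
Qed.

Lemma cintegrable_exprn (mu : {finite_measure set (measurableTypeR R) -> \bar R}) n :
  rintegrable mu (fun t => t ^+ n * expR (0 * t)) <->
  cintegrable mu (fun x => x%:C ^+ n).
Proof.
rewrite /cintegrable.
have -> : (fun x : R => (complex.Re (x%:C ^+ n))%:E) =
    EFin \o (fun t => t ^+ n * expR (0 * t)).
  by apply/funext => t; rewrite -rmorphXn /= mul0r expR0 mulr1.
have -> : (fun x : R => (complex.Im (x%:C ^+ n))%:E) = EFin \o (fun=> 0).
  by apply/funext => t; rewrite -rmorphXn.
by split=> [h|[]//]; split => //; exact: rintegrable_cst.
Qed.

Lemma cintegral_exprn (mu : {finite_measure set (measurableTypeR R) -> \bar R}) n :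
  cintegral mu (fun x => x%:C ^+ n) = (exp_moment mu 0 n)%:C.
Proof.
rewrite /cintegral; congr (_ +i* _).
  congr (Rintegral _ _ _); apply/funext => t.
  by rewrite -rmorphXn /= mul0r expR0 mulr1.
have -> : (fun x : R => complex.Im (x%:C ^+ n)) = (fun=> 0).
  by apply/funext => t; rewrite -rmorphXn.
by rewrite -[Rintegral _ _ _]/(rintegral mu _) rintegral_cst mul0r.
Qed.

(** Trades holomorphy of the transform for an integrable weight, the form in which both parts of the
    theorem handle the measure. *)
Lemma analytic_moment_functionalP (tau : nat -> R[i]) :
  analytic_moment_functional tau <->
  exists mu : {finite_measure set (measurableTypeR R) -> \bar R},
  exists2 r : R, 0 < r & rintegrable mu (exp_weight 0 r) /\
    forall n, tau n = (exp_moment mu 0 n)%:C.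
Proof.
split=> [[mu [/exp_weight_of_analytic_laplace[r r0 wi] H]]|[mu [r r0 [wi H]]]].
  exists mu, r => //; split => // n.
  by have [_ ->] := H n; rewrite cintegral_exprn.
exists mu; split; first exact: has_analytic_laplace_of_exp_weight r0 wi.
move=> n; rewrite cintegral_exprn; split => //.
apply/cintegrable_exprn; exact: rintegrable_exp_moment r0 wi.
Qed.

Lemma exp_seriesE (tau : nat -> R[i]) (l : R) :
  exp_series tau l = series (fun n => tau n / n`!%:R * l%:C ^+ n).
Proof.
by congr series; apply/funext => n; rewrite mulrAC -mulrA mulrC.
Qed.

Lemma moment_exp_series (tau : nat -> R[i]) : analytic_moment_functional tau ->
  exists a : \bar R,
    [/\ (0 < a)%E,
        forall l : R, sym_itv (2%:E * a)%E l -> cvgn (exp_series tau l) &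
        exponentially_convex a (fun l : R => limn (exp_series tau l))].
Proof.
move=> /analytic_moment_functionalP[mu [r r0 [wi tauE]]].
have r2 : 0 < r / 2 by rewrite divr_gt0.
have cv l : sym_itv (2%:E * (r / 2)%:E)%E l ->
    exp_series tau l @ \oo --> (exp_moment mu l 0)%:C.
  rewrite sym_itvE -EFinM lte_fin mulrC divfK // => lr.
  rewrite exp_seriesE.
  have -> : (fun n => tau n / n`!%:R * l%:C ^+ n) =
      (fun n => (exp_moment mu 0 n / n`!%:R)%:C * l%:C ^+ n).
    by apply/funext => n; rewrite tauE rmorphM fmorphV rmorph_nat.
  rewrite series_real_complex; apply: cvg_real_complex.
  by have := exp_moment_pseries r0 (ltW lr) wi; rewrite add0r.
exists (r / 2)%:E; split; first by rewrite lte_fin.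
  by move=> l /cv h; apply/cvg_ex; eexists; exact: h.
apply: (exponentially_convex_laplace (mu := mu)) => l lr.
rewrite (cvg_lim _ (cv l lr)); last exact: norm_hausdorff.
have e0 : (fun t : R => t ^+ 0 * expR (l * t)) = (fun t => expR (l * t)).
  by apply/funext => t; rewrite mul1r.
rewrite /exp_moment e0; split => //.
move: lr; rewrite sym_itvE -EFinM lte_fin mulrC divfK // => lr.
have s0 : 0 < r - `|l| by rewrite subr_gt0.
rewrite -e0; apply: (rintegrable_exp_moment _ s0).
by apply: rintegrable_exp_weight wi; rewrite subr0 addrC subrK.
Qed.

Lemma exponentially_convex_subset (a b : \bar R) (k k' : R -> R[i]) :
  (b <= a)%E -> (forall x, sym_itv (2%:E * b)%E x -> k x = k' x) ->
  exponentially_convex a k -> exponentially_convex b k'.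
Proof.
move=> ba kk /exponentially_convexP H; apply/exponentially_convexP => N f x xb.
have /(H N f) : forall i, sym_itv a (x i).
  by move=> i; have := xb i; rewrite !sym_itvE => /lt_le_trans; apply.
congr (0 <= _); apply: eq_bigr => i _; apply: eq_bigr => j _.
by rewrite kk //; exact: sym_itv_double.
Qed.

Lemma exp_series_moment (tau : nat -> R[i]) (a : \bar R) : (0 < a)%E ->
  (forall l : R, sym_itv (2%:E * a)%E l -> cvgn (exp_series tau l)) ->
  exponentially_convex a (fun l : R => limn (exp_series tau l)) ->
  analytic_moment_functional tau.
Proof.
move=> a0 cv ec.
(* A finite bound in place of the possibly infinite [a]. *)
have [b b0 ba] : exists2 b : R, 0 < b & (b%:E <= a)%E.
  case: a a0 {cv ec} => [a| |] // a0; first by exists a.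
  by exists 1; rewrite ?leey.
pose k l : R[i] := limn (exp_series tau l).
have subs l : `|l| < 2 * b -> sym_itv (2%:E * a)%E l.
  move=> lb; rewrite sym_itvE; apply: (@lt_le_trans _ _ (2%:E * b%:E)%E).
    by rewrite -EFinM lte_fin.
  by rewrite lee_wpmul2l.
have kc l : `|l| < 2 * b ->
    series (fun n => tau n / n`!%:R * (l - 0)%:C ^+ n) @ \oo --> k l.
  by move=> lb; rewrite subr0 -exp_seriesE; apply: cv; exact: subs.
have kre l : `|l| < 2 * b -> k l = (complex.Re (k l))%:C.
  move=> /subs /(exponentially_convex_ge0 ec); rewrite -/(k l).
  by case: (k l) => p q; rewrite lecE /= => /andP[/eqP -> _].
pose t n := complex.Re (tau n).
have tauRe n : complex.Re (tau n / n`!%:R) = t n / n`!%:R.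
  rewrite /t -(rmorph_nat (real_complex R)) -fmorphV.
  by case: (tau n) => p q /=; rewrite mulr0 subr0.
have kt l : `|l| < 2 * b -> pseries (fun n => t n / n`!%:R) l @ \oo --> complex.Re (k l).
  move=> lb; rewrite (_ : pseries _ _ =
      fun n => complex.Re (series (fun n => tau n / n`!%:R * (l - 0)%:C ^+ n) n)).
    by apply: cvg_complex_Re; exact: kc.
  apply/funext => n; rewrite subr0 /pseries /series /=.
  elim: n => [|n IH]; first by rewrite !big_geq.
  rewrite !big_nat_recr //= IH -tauRe -rmorphXn.
  by case: (\sum_(0 <= i < n) _) (tau n / _) => [p q] [p' q'] /=; rewrite mulr0 subr0.
have b2 : 0 < 2 * b by rewrite mulr_gt0.
(* As [k] is real, it is the sum of the series of [tau] and also of that of the real parts; its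
   derivatives at 0 determine the coefficients. *)
have tau_real n : tau n = (t n)%:C.
  have h1 := @cderive1n_pseries _ k 0 (2 * b) _ b2.
  have e1 := h1 (fun n => tau n / n`!%:R) _ n.
  have e2 := h1 (fun n => (t n / n`!%:R)%:C) _ n.
  have f0 : n`!%:R != 0 :> R[i] by rewrite pnatr_eq0 -lt0n fact_gt0.
  have : n`!%:R * (tau n / n`!%:R) = n`!%:R * (t n / n`!%:R)%:C.
    rewrite -e1 -?e2 // => l; rewrite subr0 => lb; last by have := kc l lb; rewrite subr0.
    rewrite series_real_complex kre //; apply: cvg_real_complex; exact: kt.
  by move=> /(mulfI f0); rewrite rmorphM fmorphV rmorph_nat => /(mulIf (invr_neq0 f0)).
have /hamburger[mu muP] : hankel_nonneg t.
  apply: (hankel_nonneg_of_kernel b2 kt) => N c x xb.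
  apply: (exponentially_convex_form _ _ ec) => i.
  rewrite sym_itvE; apply: lt_le_trans ba; rewrite lte_fin (lt_le_trans (xb i)) //.
  by rewrite mulrC mulKf.
have mE n : (fun u : R => u ^+ n * expR (0 * u)) = (fun u => u ^+ n).
  by apply/funext => u; rewrite mul0r expR0 mulr1.
have mt n : exp_moment mu 0 n = t n by rewrite /exp_moment mE; have [] := muP n.
apply/analytic_moment_functionalP; exists mu, b => //; split; last first.
  by move=> n; rewrite mt.
have bb : `|b| < 2 * b by rewrite gtr0_norm //; lra.
(* Both b and -b lie strictly inside (-2b, 2b), where the series converges. *)
apply: rintegrable_exp_weight_of_pseries.
- by move=> n; rewrite mE; have [] := muP n.
- under eq_fun do rewrite mt.
  by apply/cvg_ex; eexists; exact: kt.
- under eq_fun do rewrite mt.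
  by apply/cvg_ex; eexists; apply: kt; rewrite normrN.
Qed.

End AnalyticMoments.

Theorem theorem6p7 (R : realType) :
  (forall tau : nat -> R[i],
     analytic_moment_functional tau <->
     exists a : \bar R,
       [/\ (0 < a)%E,
           forall l : R, sym_itv (2%:E * a)%E l -> cvgn (exp_series tau l) &
           exponentially_convex a (fun l : R => limn (exp_series tau l))]) /\
  (forall (a : \bar R) (k : R -> R[i]),
     (0 < a)%E ->
     real_analytic_on (sym_itv (2%:E * a)%E) k ->
     (exponentially_convex a k <->
      analytic_moment_functional (fun n => cderive1n n k 0))).
Proof.
split=> [tau|a k a0 kan].
  split; first exact: moment_exp_series.
  by move=> [a [a0 cv ec]]; exact: exp_series_moment a0 cv ec.
have U0 : sym_itv (2%:E * a)%E (0 : R).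
  by rewrite sym_itvE normr0 mule_gt0 // lte_fin.
split=> [ec|].
  have [c /nbhs_ballP[r /= r0 kc]] := kan 0 U0.
  have {}kc y : `|y - 0| < r -> series (fun n => c n * (y - 0)%:C ^+ n) @ \oo --> k y.
    by move=> yr; apply: kc; rewrite /ball /= distrC.
  have tauE l : exp_series (fun n => cderive1n n k 0) l =
      series (fun n => c n * (l - 0)%:C ^+ n).
    rewrite exp_seriesE; congr series; apply/funext => n.
    by rewrite (cderive1n_pseries r0 kc) subr0 (mulrC n`!%:R) mulfK // pnatr_eq0 -lt0n fact_gt0.
  (* The Taylor series at 0 is known to represent [k] only for |l| < r, so (a) is applied on an
     interval with 2b <= r. *)
  pose b := Order.min a (r / 2)%:E.
  have b0 : (0 < b)%E by rewrite lt_min a0 lte_fin divr_gt0.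
  have br l : sym_itv (2%:E * b)%E l -> `|l - 0| < r.
    rewrite sym_itvE subr0 -lte_fin => /lt_le_trans; apply.
    apply: (@le_trans _ _ (2%:E * (r / 2)%:E)%E).
      by rewrite lee_wpmul2l // ge_min lexx orbT.
    by rewrite -EFinM mulrC divfK.
  apply: (exp_series_moment b0) => [l lb|].
    by rewrite tauE; apply/cvg_ex; eexists; exact: kc (br _ lb).
  apply: exponentially_convex_subset ec; first by rewrite ge_min lexx.
  move=> l lb; rewrite tauE; apply/esym/cvg_lim; first exact: norm_hausdorff.
  exact: kc (br _ lb).
move=> /analytic_moment_functionalP[mu [r r0 [wi tauE]]].
have j0 : laplace_jet mu k 0.
  by split => [n|n]; [exact: rintegrable_exp_moment r0 wi|exact: tauE].
apply: (exponentially_convex_laplace (mu := mu)) => x xU.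
have [xi xm] : laplace_jet mu k x.
  (* The segment from 0 to x stays in the symmetric interval, where [k] is analytic at every
     point. *)
  apply: (laplace_jet_segment j0) => s /andP[s0 s1]; apply: kan.
  move: xU; rewrite !sym_itvE; apply: le_lt_trans.
  by rewrite lee_fin normrM ger0_norm // ler_piMl.
have e0 : (fun t : R => t ^+ 0 * expR (x * t)) = (fun t => expR (x * t)).
  by apply/funext => t; rewrite mul1r.
split; first by have := xi 0%N; rewrite e0.
by have := xm 0%N; rewrite /exp_moment e0.
Qed.
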